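(* Let $n\ge 1$, let $\boldsymbol{a},\boldsymbol{b}\in\mathbb{R}^n$ with $a_i<b_i$ for all $i$, and let $f:[\boldsymbol{a},\boldsymbol{b}]\to\mathbb{R}$ be of bounded variation on the rectangle $[\boldsymbol{a},\boldsymbol{b}]=\prod_{i=1}^n[a_i,b_i]$. Then the joint derivative $f^{(n)}(\boldsymbol{x})$ exists for almost every $\boldsymbol{x}\in[\boldsymbol{a},\boldsymbol{b}]$, and $$\int_{[\boldsymbol{a},\boldsymbol{b}]}|f^{(n)}(\boldsymbol{x})|\,d\boldsymbol{x}\le\bigvee_{\boldsymbol{a}}^{\boldsymbol{b}}(f).$$
   Context: For $\boldsymbol{c},\boldsymbol{d}\in\mathbb{R}^n$ with $c_i\le d_i$ for all $i$, $[\boldsymbol{c},\boldsymbol{d}]=\prod_i[c_i,d_i]$. The joint increment of $f$ over $[\boldsymbol{c},\boldsymbol{d}]$ is $$\Delta_f^n[\boldsymbol{c},\boldsymbol{d}]=\sum_{\epsilon_1,\dots,\epsilon_n\in\{0,1\}}(-1)^{n+\epsilon_1+\dots+\epsilon_n}f\big(c_1+\epsilon_1(d_1-c_1),\dots,c_n+\epsilon_n(d_n-c_n)\big).$$ The joint derivative of $f$ at a point $\boldsymbol{x}$ in a neighborhood of which $f$ is defined is $$f^{(n)}(\boldsymbol{x})=\lim_{h\to0^+}\frac{\Delta_f^n\big([x_1,x_1+h]\times\dots\times[x_n,x_n+h]\big)}{h^n},$$ when the limit exists (as a finite real number). The total variation of $f$ on $[\boldsymbol{a},\boldsymbol{b}]$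 is $$\bigvee_{\boldsymbol{a}}^{\boldsymbol{b}}(f)=\sup_{\Delta}\sum_{i=1}^{N^n}|\Delta_f^nI_i|,$$ where the supremum is over all $N\ge1$ and all grid partitions $\Delta: a_i=x_{i0}<x_{i1}<\dots<x_{iN}=b_i$ ($i=1,\dots,n$), and $I_1,\dots,I_{N^n}$ are the closed sub-rectangles generated by $\Delta$. $f$ is of bounded variation on $[\boldsymbol{a},\boldsymbol{b}]$ if $\bigvee_{\boldsymbol{a}}^{\boldsymbol{b}}(f)<+\infty$. Integrals are Lebesgue integrals; $f^{(n)}$ is integrated as an almost everywhere defined function. *)

(* Defs.v *)
From HB Require Import structures.
From mathcomp Require Import all_boot all_order all_algebra.
From mathcomp Require Import all_classical all_reals all_analysis.

Set Implicit Arguments.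
Unset Strict Implicit.
Unset Printing Implicit Defensive.

Import Order.TTheory GRing.Theory Num.Theory.
Import numFieldNormedType.Exports.

Local Open Scope classical_set_scope.
Local Open Scope ring_scope.

(* Points of R^n are n-tuples over [measurableTypeR R] (a copy of R carrying
   the Borel sigma-algebra), so that R^n gets the product sigma-algebra. *)
Notation Rn R n := (n.-tuple (measurableTypeR R)).

Section lebesgue_measure_Rn.
Context {R : realType}.

Definition cons_Rn n (p : measurableTypeR R * Rn R n) : Rn R n.+1 :=
  [the n.+1.-tuple _ of p.1 :: p.2].

Lemma measurable_cons_Rn n : measurable_fun [set: _] (@cons_Rn n).
Proof. exact: measurable_cons. Qed.

Section step.
Variables (n : nat) (mu : {sigma_finite_measure set (Rn R n) -> \bar R}).

Definition lebesgue_step : set (Rn R n.+1) -> \bar R :=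
  pushforward (@lebesgue_measure R \x mu)%E (@cons_Rn n).

Let preimage_cons A : measurable A -> measurable (@cons_Rn n @^-1` A).
Proof.
by move=> mA; rewrite -[X in measurable X]setTI; exact: measurable_cons_Rn.
Qed.

Let lebesgue_step0 : lebesgue_step set0 = 0%E.
Proof. by rewrite /lebesgue_step /pushforward preimage_set0 measure0. Qed.

Let lebesgue_step_ge0 A : (0 <= lebesgue_step A)%E.
Proof.
exact: (measure_ge0 (@lebesgue_measure R \x mu)%E).
Qed.

Let lebesgue_step_sigma_additive : semi_sigma_additive lebesgue_step.
Proof.
move=> F mF tF mUF; rewrite /lebesgue_step /pushforward preimage_bigcup.
apply: measure_semi_sigma_additive.
- by move=> k; exact: preimage_cons.
- apply/trivIsetP => /= i j _ _ ij; rewrite -preimage_setI.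
  by move/trivIsetP : tF => /(_ _ _ _ _ ij) ->//; rewrite preimage_set0.
- by rewrite -preimage_bigcup; exact: preimage_cons.
Qed.

HB.instance Definition _ := isMeasure.Build _ _ _ lebesgue_step
  lebesgue_step0 lebesgue_step_ge0 lebesgue_step_sigma_additive.

Let lebesgue_step_sigma_finite : sigma_finite [set: Rn R n.+1] lebesgue_step.
Proof.
have [H TH Hoo] : sigma_finite [set: _] (@lebesgue_measure R \x mu)%E.
  have /sigma_finiteP[F [TF ndF Foo]] := sigma_finiteT (@lebesgue_measure R).
  have /sigma_finiteP[G [TG ndG Goo]] := sigma_finiteT mu.
  exists (fun k => F k `*` G k).
    rewrite -setXTT TF TG predeqE => -[x y]; split.
      move=> [/= [k _ Fkx] [l _ Gly]]; exists (maxn k l) => //; split.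
      - by move: x Fkx; exact/subsetPset/ndF/leq_maxl.
      - by move: y Gly; exact/subsetPset/ndG/leq_maxr.
    by move=> [k _ []/= ? ?]; split; exists k.
  move=> k; have [? ?] := Foo k; have [? ?] := Goo k.
  split; first exact: measurableX.
  by rewrite product_measure1E// lte_mul_pinfty// ge0_fin_numE.
pose u (t : Rn R n.+1) : measurableTypeR R * Rn R n :=
  (thead t, [tuple of behead t]).
have consK : cancel (@cons_Rn n) u.
  by move=> [x t]; congr pair; apply/val_inj.
have mu_ : measurable_fun [set: _] u.
  apply: measurable_fun_pair; first exact: measurable_tnth.
  exact: measurable_behead.
exists (fun k => u @^-1` H k); first by rewrite -preimage_bigcup -TH.
move=> k; have [mH Hk] := Hoo k; split.
  by rewrite -[X in measurable X]setTI; exact: mu_.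
rewrite /lebesgue_step /pushforward -comp_preimage.
by rewrite (_ : u \o _ = id) //; apply/funext => p /=; rewrite consK.
Qed.

HB.instance Definition _ := Measure_isSigmaFinite.Build _ _ _ lebesgue_step
  lebesgue_step_sigma_finite.

End step.

(* n-dimensional Lebesgue measure on Borel sets, by iterated products. *)
Fixpoint lebesgue_Rn n : {sigma_finite_measure set (Rn R n) -> \bar R} :=
  match n with
  | 0 => \d_ (@nil_tuple (measurableTypeR R))
  | n'.+1 => lebesgue_step (lebesgue_Rn n')
  end.

(* A copy of R^n carrying the sigma-algebra of Lebesgue measurable sets. *)
Definition lebesgue_type n := caratheodory_type ((lebesgue_Rn n)^*)%mu.

HB.instance Definition _ n := Measurable.on (lebesgue_type n).

(* The complete measure: its sigma-algebra contains every null set. *)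
Definition completed_lebesgue_Rn n : set (lebesgue_type n) -> \bar R :=
  @completed_measure_extension _ _ _ (lebesgue_Rn n).

HB.instance Definition _ n := Measure.on (completed_lebesgue_Rn (n := n)).

Lemma completed_lebesgue_Rn_is_complete n :
  measure_is_complete (@completed_lebesgue_Rn n).
Proof. exact: measure_is_complete_caratheodory. Qed.

End lebesgue_measure_Rn.
Arguments lebesgue_Rn : clear implicits.
Arguments lebesgue_type : clear implicits.
Arguments completed_lebesgue_Rn : clear implicits.

Section joint_variation.
Context {R : realType} {n : nat}.
Implicit Types (a b c d x : n.-tuple R) (f : n.-tuple R -> R).

Definition rectangle a b : set (n.-tuple R) :=
  [set x | forall i, tnth a i <= tnth x i <= tnth b i].

Definition joint_increment f c d : R :=
  \sum_(e : {ffun 'I_n -> bool})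
    (-1) ^+ (n + \sum_(i < n) e i) *
    f [tuple tnth c i + (e i)%:R * (tnth d i - tnth c i) | i < n].

Definition joint_quotient f x (h : R) : R :=
  joint_increment f x [tuple tnth x i + h | i < n] / h ^+ n.

(* [f] is only meaningful on [rectangle a b]: the derivative is considered at
   points having a neighborhood included in that rectangle. *)
Definition joint_derivable a b f x : Prop :=
  (forall i, tnth a i < tnth x i < tnth b i) /\
  cvg (joint_quotient f x h @[h --> 0^'+]).

(* Arbitrary where the limit does not exist. *)
Definition joint_derivative f x : R := lim (joint_quotient f x h @[h --> 0^'+]).

(* [p i j] is the j-th node (0 <= j <= N) on the i-th axis; the values [p i j]
   for j > N are irrelevant. *)
Definition grid_partition a b (N : nat) (p : 'I_n -> nat -> R) : Prop :=
  forall i, [/\ p i 0%N = tnth a i, p i N = tnth b i &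
                forall j, (j < N)%N -> p i j < p i j.+1].

(* The N ^ n cells are indexed by k : {ffun 'I_n -> 'I_N}. *)
Definition grid_variation f (N : nat) (p : 'I_n -> nat -> R) : R :=
  \sum_(k : {ffun 'I_n -> 'I_N})
    `|joint_increment f [tuple p i (k i) | i < n] [tuple p i (k i).+1 | i < n]|.

Definition joint_total_variation a b f : \bar R :=
  ereal_sup [set v | exists N p, [/\ (1 <= N)%N, grid_partition a b N p &
                                    v = (grid_variation f N p)%:E]].

Definition joint_bounded_variation a b f : Prop :=
  (joint_total_variation a b f < +oo)%E.

End joint_variation.

(* Main.v *)
Require Import Defs.
From mathcomp Require Import all_boot all_order all_algebra.
From mathcomp Require Import all_classical all_reals all_analysis.
From mathcomp Require Import measurable_realfun.
From mathcomp Require Import zify ring lra.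

(** Why the theorem is true.

    Cut [a, b] into 2^(nk) equal dyadic cells and let r_k(x) be the increment
    of f over the level k cell of x, divided by the volume of that cell.  The
    proof shows that r_k converges almost everywhere, that the limit D(x) is
    the joint derivative, and that the integral bound passes to the limit.

    Convergence.  Let V(Q) be the variation of f inside a cell Q, that is the
    supremum of the sums of |increment| over finite families of nonoverlapping
    boxes in Q.  V is superadditive by construction and finite because such a
    family refines to a grid ([packing_sum_le]).  As the increment is additive,
    V and V + increment are nonnegative and superadditive, so their ratios to
    the volume are nonnegative supermartingales along the dyadic filtration.
    Dubins' upcrossing inequality ([measure_crossing]) makes them converge
    almost everywhere ([ae_cvg_cell_ratio]), hence so does r_k.

    From dyadic cells to cubes [x, x + h].  Such a cube is essentially a union
    of boundedly many cells of side about h / m, but these cells need not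
    contain x.  A density argument fills the gap ([ae_near_cells]): if the
    cells containing x eventually have some property, then almost surely so do
    all the cells at a bounded number of steps from x.  The maximal cells
    without the property are disjoint, so the measures of their enlargements
    have a finite sum and the Borel-Cantelli lemma applies.  Applied to the
    properties p <= r_k <= q (p, q rational) and V(Q) <= lambda vol(Q), it
    shows that the cells inside the cube contribute D vol up to a small error,
    while the O(m^(n-1)) cells that meet its boundary contribute at most
    lambda + |D| times their volume, a fraction O(1/m) of h^n
    ([cube_increment_bound], [cvg_joint_quotient]).

    Integral.  The step functions |r_k| have integral
    sum_Q |increment over Q|, the variation of f over a grid; Fatou's lemma
    concludes, and measurability comes from the completeness of the measure
    ([measurable_ae_limit], [integral_ae_limit_le]). *)

Import Order.TTheory GRing.Theory Num.Theory.
Import numFieldNormedType.Exports.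

Local Open Scope classical_set_scope.
Local Open Scope ring_scope.

Set Implicit Arguments.
Unset Strict Implicit.
Unset Printing Implicit Defensive.

(** * Additivity of the joint increment *)

Section grid_additivity.
Context {R : realType} {n : nat}.
Implicit Types f : n.-tuple R -> R.

Lemma prod_indicator (I : finType) (J : eqType) (y z : I -> J) :
  \prod_(i : I) (y i == z i)%:R = [forall i, y i == z i]%:R :> R.
Proof.
case: (boolP [forall i, _]) => [/forallP yz|].
  by apply: big1 => i _; rewrite yz.
rewrite negb_forall => /existsP[i /negPf yzi].
by rewrite (bigD1 i) //= yzi mul0r.
Qed.

(** Between two vertices of a grid the increment has product form: the weight
    of a vertex is the product over the axes of the one-dimensional weights,
    +1 at the upper end and -1 at the lower end. *)
Lemma joint_increment_nodes f N (P : 'I_n -> nat -> R) (l r : 'I_n -> 'I_N) :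
  joint_increment f [tuple P i (l i) | i < n] [tuple P i (r i) | i < n] =
  \sum_(y : {ffun 'I_n -> 'I_N}) f [tuple P i (y i) | i < n] *
    \prod_(i < n) ((y i == r i)%:R - (y i == l i)%:R).
Proof.
pose z (e : {ffun 'I_n -> bool}) := [ffun i => if e i then r i else l i].
have prodE (y : {ffun 'I_n -> 'I_N}) :
    \prod_(i < n) ((y i == r i)%:R - (y i == l i)%:R) =
    \sum_(e : {ffun 'I_n -> bool})
      (-1) ^+ (n + \sum_(i < n) e i) * (y == z e)%:R :> R.
  transitivity (\prod_(i < n) \sum_(b : bool)
      ((-1) ^+ (1 + b) * (y i == if b then r i else l i)%:R : R)).
    apply: eq_bigr => i _; rewrite big_bool /= addn0 expr1 addn1 sqrrN expr1n.
    by rewrite mul1r mulN1r.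
  rewrite bigA_distr_bigA; apply: eq_bigr => e _.
  rewrite big_split /= prodrXr big_split /= sum1_card card_ord; congr (_ * _).
  rewrite prod_indicator; congr (_%:R); congr nat_of_bool.
  apply/forallP/eqP => [yz|-> i]; last by rewrite ffunE.
  by apply/ffunP => i; rewrite ffunE; exact/eqP.
under eq_bigr => y _ do rewrite prodE mulr_sumr.
rewrite exchange_big /=; apply: eq_bigr => e _.
rewrite (bigD1 (z e)) //= eqxx mulr1 [X in _ = _ + X]big1 ?addr0; last first.
  by move=> y yz; rewrite (negbTE yz) !mulr0.
rewrite mulrC; congr (f _ * _); apply: eq_mktuple => i; rewrite !tnth_mktuple ffunE.
by case: (e i); rewrite ?mul1r ?mul0r ?addr0 // addrC subrK.
Qed.

(** On each axis the weight of [l i, r i] is the telescoping sum of the weights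
    of the unit steps; distributing the product over these sums gives the sum
    over the cells of the grid. *)
Lemma joint_increment_grid f N (P : 'I_n -> nat -> R) (l r : 'I_n -> nat) :
  (forall i, (l i <= r i <= N)%N) ->
  joint_increment f [tuple P i (l i) | i < n] [tuple P i (r i) | i < n] =
  \sum_(k : {ffun 'I_n -> 'I_N} | [forall i, (l i <= k i < r i)%N])
    joint_increment f [tuple P i (k i) | i < n] [tuple P i (k i).+1 | i < n].
Proof.
move=> lrN.
have ltP (m : 'I_n -> nat) : (forall i, (m i <= N)%N) ->
    exists m' : 'I_n -> 'I_N.+1, m = m' :> ('I_n -> nat).
  by move=> mN; exists (fun i => Ordinal (mN i : (m i < N.+1)%N)).
have [i|l' lE] := ltP l; first by have /andP[/leq_trans] := lrN i; apply.
have [i|r' rE] := ltP r; first by have /andP[] := lrN i.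
transitivity (\sum_(k : {ffun 'I_n -> 'I_N} | [forall i, (l i <= k i < r i)%N])
    \sum_(y : {ffun 'I_n -> 'I_N.+1}) f [tuple P i (y i) | i < n] *
    \prod_(i < n) (((y i : nat) == (k i).+1)%:R - ((y i : nat) == k i)%:R));
  last first.
  apply: eq_bigr => k _.
  pose k0 i := widen_ord (leqnSn N) (k i).
  pose k1 i := lift ord0 (k i).
  rewrite (_ : [tuple P i (k i).+1 | i < n] = [tuple P i (k1 i) | i < n]) //.
  rewrite (_ : [tuple P i (k i) | i < n] = [tuple P i (k0 i) | i < n]) //.
  by rewrite joint_increment_nodes.
rewrite exchange_big /= lE rE joint_increment_nodes; apply: eq_bigr => y _.
rewrite -mulr_sumr; congr (_ * _).
pose F i (q : nat) : R := ((y i : nat) == q.+1)%:R - ((y i : nat) == q)%:R.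
rewrite -[RHS]/(\sum_(k : {ffun 'I_n -> 'I_N} |
  [forall i, (l' i <= k i < r' i)%N]) \prod_(i < n) F i (k i)).
transitivity (\prod_(i < n) \sum_(q < N | (l' i <= q < r' i)%N) F i q).
  apply: eq_bigr => i _.
  have /andP[lr rN] : (l' i <= r' i <= N)%N by have := lrN i; rewrite lE rE.
  rewrite -(big_mkord (fun q => (l' i <= q < r' i)%N) (F i)).
  rewrite (@big_cat_nat _ _ _ (r' i)) //= [X in _ = _ + X]big1_seq ?addr0; last first.
    by move=> q; rewrite mem_index_iota => /andP[/andP[_ q1] /andP[q2 _]]; lia.
  rewrite (@big_cat_nat _ _ _ (l' i)) //= [X in _ = X + _]big1_seq ?add0r; last first.
    by move=> q; rewrite mem_index_iota => /andP[/andP[q1 _] /andP[_ q2]]; lia.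
  rewrite big_nat_cond (eq_bigl (fun q => (l' i <= q < r' i)%N)); last first.
    by move=> q; lia.
  by rewrite -big_nat (telescope_sumr (fun q => ((y i : nat) == q)%:R)).
rewrite (bigA_distr_big_dep (fun i (q : 'I_N) => (l' i <= q < r' i)%N)).
by apply: eq_bigl => k; apply/familyP/forallP => h i; have := h i.
Qed.

(** Volume is itself a joint increment, hence additive over grids. *)
Lemma joint_increment_volume (c d : n.-tuple R) :
  joint_increment (fun x => \prod_(i < n) tnth x i) c d =
  \prod_(i < n) (tnth d i - tnth c i).
Proof.
transitivity (\prod_(i < n) \sum_(b : bool)
    ((-1) ^+ (1 + b) * (tnth c i + b%:R * (tnth d i - tnth c i)) : R)).
  rewrite bigA_distr_bigA; apply: eq_bigr => e _.
  rewrite [RHS]big_split /= prodrXr big_split /= sum1_card card_ord.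
  by congr (_ * _); apply: eq_bigr => i _; rewrite tnth_mktuple.
by apply: eq_bigr => i _; rewrite big_bool /=; ring.
Qed.

End grid_additivity.

(** * Variation over packings of boxes *)

Section packing_variation.
Context {R : realType} {n : nat}.
Variables (a b : n.-tuple R) (f : n.-tuple R -> R).
Local Notation w i := (tnth b i - tnth a i).
Local Notation coords := {ffun 'I_n -> R}.
Local Notation box := (coords * coords)%type.

(** Boxes are described in the coordinates in which [a, b] becomes the unit
    cube.  All axes then share one list of nodes, so that a family of boxes
    refines to a grid with the same number of steps on every axis. *)
Definition unit_point (t : 'I_n -> R) : n.-tuple R :=
  [tuple tnth a i + w i * t i | i < n].

Definition box_increment (I : box) : R :=
  joint_increment f (unit_point I.1) (unit_point I.2).

Definition sub_box (I J : box) : bool :=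
  [forall i, [&& J.1 i <= I.1 i, I.1 i <= I.2 i & I.2 i <= J.2 i]].

Definition nonoverlapping (I J : box) : bool :=
  [exists i, (I.2 i <= J.1 i) || (J.2 i <= I.1 i)].

Definition packing (J : box) (F : seq box) : bool :=
  all (sub_box^~ J) F && pairwise nonoverlapping F.

Definition unit_box : box := ([ffun=> 0], [ffun=> 1]).

Lemma sub_box_trans (I J K : box) : sub_box I J -> sub_box J K -> sub_box I K.
Proof.
move=> /forallP IJ /forallP JK; apply/forallP => i.
move: (IJ i) (JK i) => /and3P[h1 h2 h3] /and3P[h4 h5 h6].
by rewrite h2 (le_trans h4) // (le_trans h3).
Qed.

Lemma sub_box_refl (I J : box) : sub_box I J -> sub_box I I.
Proof.
move=> /forallP IJ; apply/forallP => i.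
by have /and3P[_ I12 _] := IJ i; rewrite !lexx I12.
Qed.

Lemma nonoverlappingC (I J : box) : nonoverlapping I J = nonoverlapping J I.
Proof. by apply/existsP/existsP => -[i]; exists i; rewrite orbC. Qed.

Lemma sub_nonoverlapping (I I' J J' : box) :
  sub_box I I' -> sub_box J J' -> nonoverlapping I' J' -> nonoverlapping I J.
Proof.
move=> /forallP II' /forallP JJ' /existsP[i IJ]; apply/existsP; exists i.
move: (II' i) (JJ' i) IJ => /and3P[h1 h2 h3] /and3P[h4 h5 h6] /orP[] IJ.
  by rewrite (le_trans h3) // (le_trans IJ).
by rewrite (le_trans h6) ?orbT // (le_trans IJ).
Qed.

Variable TV : R.
Hypothesis ab : forall i, tnth a i < tnth b i.
Hypothesis TV_ub : forall N p, (1 <= N)%N -> grid_partition a b N p ->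
  grid_variation f N p <= TV.

(** All the coordinates of all the boxes, sorted, are the nodes of a grid.
    Each increment splits over the cells of the grid inside its box, and a cell
    lies in at most one box. *)
Lemma packing_sum_le (F : seq box) : packing unit_box F ->
  \sum_(I <- F) `|box_increment I| <= TV.
Proof.
move=> /andP[/allP Fu FF].
pose ends := flatten (map (fun I : box => codom I.1 ++ codom I.2) F).
pose s := sort <=%R (undup (0 :: 1 :: ends)).
pose N := (size s).-1.
have s_sorted : sorted <%R s by rewrite sort_lt_sorted undup_uniq.
have mem_s x : (x \in s) = (x \in 0 :: 1 :: ends) by rewrite mem_sort mem_undup.
have s0 : 0 \in s by rewrite mem_s !inE eqxx.
have s1 : 1 \in s by rewrite mem_s !inE eqxx orbT.
have endsP I i : I \in F -> (I.1 i \in s) /\ (I.2 i \in s).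
  move=> IF; rewrite !mem_s !inE; split; apply/orP; right; apply/orP; right;
  by apply/flattenP; exists (codom I.1 ++ codom I.2);
    [apply/mapP; exists I | rewrite mem_cat codom_f ?orbT].
have s01 x : x \in s -> 0 <= x <= 1.
  rewrite mem_s !inE => /or3P[/eqP->|/eqP->|]; rewrite ?lexx ?ler01 //.
  move=> /flattenP[_ /mapP[I IF ->]].
  have /forallP Iu := Fu _ IF.
  by rewrite mem_cat => /orP[] /codomP[i ->]; have := Iu i;
    rewrite !ffunE => /and3P[h1 h2 h3]; lra.
have s_size : (1 < size s)%N.
  have : uniq [:: 0; 1 : R] by rewrite /= inE eq_sym oner_eq0.
  by move/uniq_leq_size => /(_ s); apply => x; rewrite !inE => /orP[] /eqP->.
have s_le i j : (i < size s)%N -> (j < size s)%N ->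
    (nth 0 s i <= nth 0 s j) = (i <= j)%N.
  by move=> si sj; rewrite (lt_sorted_leq_nth 0 s_sorted) ?inE.
have s_lt i j : (i < size s)%N -> (j < size s)%N ->
    (nth 0 s i < nth 0 s j) = (i < j)%N.
  by move=> si sj; rewrite (lt_sorted_ltn_nth 0 s_sorted) ?inE.
have idx x : x \in s -> (index x s < size s)%N by rewrite index_mem.
have s_first : nth 0 s 0 = 0.
  apply/eqP; rewrite eq_le; apply/andP; split.
    rewrite -[leRHS](nth_index 0 s0) s_le ?idx //.
    exact: ltn_trans s_size.
  by have /andP[] := s01 _ (mem_nth 0 (ltnW s_size)).
have N_lt : (N < size s)%N by rewrite /N prednK // ltnW.
have idxN x : x \in s -> (index x s <= N)%N.
  by move=> /idx xs; rewrite -ltnS /N prednK // ltnW.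
have s_last : nth 0 s N = 1.
  apply/eqP; rewrite eq_le; apply/andP; split.
    by have /andP[] := s01 _ (mem_nth 0 N_lt).
  rewrite -[leLHS](nth_index 0 s1) s_le ?idx //.
  exact: idxN.
pose p (i : 'I_n) j := tnth a i + w i * nth 0 s j.
have pN : grid_partition a b N p.
  move=> i; split; first by rewrite /p s_first mulr0 addr0.
    by rewrite /p s_last mulr1 addrC subrK.
  move=> j jN; rewrite /p ltrD2l ltr_pM2l ?subr_gt0 ?ab //.
  by rewrite s_lt //; [exact: ltn_trans N_lt | exact: leq_ltn_trans N_lt].
have N1 : (1 <= N)%N by rewrite /N -ltnS prednK // ltnW.
apply: le_trans (TV_ub N1 pN).
pose inside (I : box) (k : {ffun 'I_n -> 'I_N}) :=
  [forall i, (index (I.1 i) s <= k i < index (I.2 i) s)%N].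
pose g (k : {ffun 'I_n -> 'I_N}) := `|joint_increment f
  [tuple p i (k i) | i < n] [tuple p i (k i).+1 | i < n]|.
have gE (I : box) : I \in F -> `|box_increment I| <= \sum_(k | inside I k) g k.
  move=> IF; apply: le_trans (ler_norm_sum _ _ _).
  rewrite -joint_increment_grid.
    rewrite le_eqVlt; apply/orP; left; apply/eqP; congr (`|joint_increment _ _ _|);
    by apply: eq_mktuple => i; rewrite /p nth_index //; have [] := endsP _ i IF.
  move=> i; have [I1 I2] := endsP _ i IF; apply/andP; split.
    rewrite -s_le ?idx // !nth_index //.
    by have /forallP/(_ i)/and3P[] := Fu _ IF.
  exact: idxN.
(* A cell of the grid lies in at most one of two nonoverlapping boxes. *)
have cross (I J : box) k : I \in F -> J \in F -> nonoverlapping I J ->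
    inside I k -> inside J k -> False.
  move=> IF JF /existsP[i IJ] /forallP/(_ i) Ik /forallP/(_ i) Jk.
  have [I1 I2] := endsP _ i IF; have [J1 J2] := endsP _ i JF.
  move: IJ; rewrite -{1}(nth_index 0 I1) -{1}(nth_index 0 I2).
  rewrite -{1}(nth_index 0 J1) -{1}(nth_index 0 J2) !s_le ?idx //.
  have /andP[I3 I4] := Ik; have /andP[J3 J4] := Jk; case/orP => IJ.
    by have := leq_ltn_trans (leq_trans IJ J3) I4; rewrite ltnn.
  by have := leq_ltn_trans (leq_trans IJ I3) J4; rewrite ltnn.
have bound : \sum_(I <- F) `|box_increment I| <=
    \sum_(I <- F) \sum_(k | inside I k) g k.
  by rewrite !big_seq; apply: ler_sum => I; exact: gE.
apply: (le_trans bound).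
rewrite (exchange_big_dep xpredT) //=; apply: ler_sum => k _.
rewrite -/(g k) big_const_seq iter_addr_0 -[leRHS]mulr1n.
apply: ler_wpMn2l; first exact: normr_ge0.
suff once F' : {subset F' <= F} -> pairwise nonoverlapping F' ->
    (count (inside^~ k) F' <= 1)%N by exact: once.
elim: F' => //= I F' IHF sF /andP[/allP IF' F'F'].
have F'F : {subset F' <= F} by move=> J JF'; apply: sF; rewrite inE JF' orbT.
case: (boolP (inside I k)) => Ik /=; last exact: IHF.
rewrite ltnS leqn0 eqn0Ngt -has_count; apply/hasPn => J JF'; apply/negP => Jk.
by apply: (cross I J k) => //; [apply: sF; rewrite inE eqxx | exact: F'F | exact: IF'].
Qed.

(** Packings are used rather than grids of [Q], because packings of disjoint
    boxes concatenate.  Inside the unit box the values are bounded by [TV], so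
    that the real supremum is then a genuine one. *)
Definition box_variation (Q : box) : R :=
  sup [set v | exists2 F, packing Q F & v = \sum_(I <- F) `|box_increment I|].

Lemma packing_sub (F : seq box) (Q Q' : box) :
  sub_box Q Q' -> packing Q F -> packing Q' F.
Proof.
move=> QQ' /andP[/allP FQ FF]; apply/andP; split=> //.
by apply/allP => I /FQ /sub_box_trans; apply.
Qed.

Lemma box_variation_ub (Q : box) (F : seq box) : sub_box Q unit_box ->
  packing Q F -> \sum_(I <- F) `|box_increment I| <= box_variation Q.
Proof.
move=> Qu QF; apply: ub_le_sup; last by exists F.
exists TV => _ [G QG ->]; apply: packing_sum_le; exact: packing_sub QG.
Qed.

Lemma box_variation_lub (Q : box) v : (forall F, packing Q F ->
  \sum_(I <- F) `|box_increment I| <= v) -> box_variation Q <= v.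
Proof.
move=> Qv; apply: ge_sup; last by move=> _ [F QF ->]; exact: Qv.
by exists 0; exists [::]; rewrite ?big_nil.
Qed.

Lemma le_box_variation (I Q : box) : sub_box Q unit_box -> sub_box I Q ->
  `|box_increment I| <= box_variation Q.
Proof.
move=> Qu IQ; have := box_variation_ub (F := [:: I]) Qu.
by rewrite big_seq1; apply; rewrite /packing /= IQ.
Qed.

(** Packings of disjoint boxes concatenate to a packing of [Q]: the suprema are
    reached one box of [L] at a time, keeping the packings [F] already chosen. *)
Lemma box_variation_super (Q : box) (L : seq box) : sub_box Q unit_box ->
  packing Q L -> \sum_(J <- L) box_variation J <= box_variation Q.
Proof.
move=> Qu QL.
suff H F : packing Q (F ++ L) ->
    \sum_(I <- F) `|box_increment I| + \sum_(J <- L) box_variation J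
      <= box_variation Q.
  by have := H [::] QL; rewrite big_nil add0r.
elim: L {QL} F => [|J L IH] F; first by rewrite big_nil addr0 cats0; exact: box_variation_ub.
rewrite /packing all_cat pairwise_cat /= => /andP[/and3P[FQ JQ LQ]].
move=> /and4P[FJL FF JL LL].
rewrite big_cons addrCA -lerBrDr; apply: box_variation_lub => G /andP[/allP GJ GG].
rewrite lerBrDr addrA -big_cat; apply: IH.
rewrite /packing !all_cat !pairwise_cat FQ LQ FF GG LL /= !andbT.
move: FJL; rewrite allrel_consr => /andP[/allP FJ FL].
apply/and3P; split.
- by apply/allP => I /GJ /sub_box_trans; apply.
- rewrite allrel_catl FL andbT; apply/allrelP => I K IG KL.
  have KK := sub_box_refl (allP LQ _ KL).
  exact: sub_nonoverlapping (GJ _ IG) KK (allP JL _ KL).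
- apply/allrelP => I K IG KF; rewrite nonoverlappingC.
  have KK := sub_box_refl (allP FQ _ KF).
  exact: sub_nonoverlapping KK (GJ _ IG) (FJ _ KF).
Qed.

End packing_variation.

(** * Lebesgue measure of products *)

Section lebesgue_products.
Context {R : realType}.
Local Open Scope ereal_scope.

Lemma measurable_tuple_prod n (A : 'I_n -> set R) :
  (forall i, measurable (A i : set (measurableTypeR R))) ->
  measurable ([set x | forall i, A i (tnth x i)] : set (Rn R n)).
Proof.
move=> mA.
rewrite (_ : [set x | _] = \bigcap_(i in [set: 'I_n])
   ((fun x : Rn R n => tnth x i) @^-1` A i)); last first.
  by apply/seteqP; split=> x /= xA => [i _|i]; exact: xA.
apply: fin_bigcap_measurable => // i _; rewrite -[X in measurable X]setTI.
exact: measurable_tnth.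
Qed.

Lemma lebesgue_Rn_prod n (A : 'I_n -> set R) :
  (forall i, measurable (A i : set (measurableTypeR R))) ->
  lebesgue_Rn R n [set x | forall i, A i (tnth x i)] =
  \prod_(i < n) lebesgue_measure (A i : set (measurableTypeR R)).
Proof.
elim: n A => [|n IHn] A mA.
  by rewrite big_ord0 /= diracE mem_set//= => -[].
rewrite big_ord_recl -(IHn (fun i => A (lift ord0 i))) //.
rewrite -product_measure1E //; last first.
  exact: (@measurable_tuple_prod _ (fun i => A (lift ord0 i))).
rewrite /= /lebesgue_step /pushforward; congr (_ _).
apply/seteqP; split=> -[x y] /=.
  move=> xyA; split; first exact: (xyA ord0).
  by move=> i; have := xyA (lift ord0 i); rewrite tnthS.
move=> [xA yA] i; case: (unliftP ord0 i) => [j ->|->]; last by [].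
by rewrite tnthS; exact: yA.
Qed.

Lemma measurable_completed n (A : set (Rn R n)) :
  measurable A -> measurable (A : set (lebesgue_type R n)).
Proof.
move=> mA; apply: (@sub_caratheodory _ _ _ (lebesgue_Rn R n)).
exact: sub_sigma_algebra.
Qed.

Lemma completed_lebesgue_RnE n (A : set (Rn R n)) : measurable A ->
  completed_lebesgue_Rn R n A = lebesgue_Rn R n A.
Proof. by move=> mA; exact: measurable_mu_extE. Qed.

(** Monotonicity and intersection of almost everywhere statements, for
    predicates on plain tuples rather than on the copy of R^n that carries the
    completed sigma-algebra. *)
Lemma ae_completedS n (P Q : n.-tuple R -> Prop) : (forall x, P x -> Q x) ->
  {ae completed_lebesgue_Rn R n, forall x, P x} ->
  {ae completed_lebesgue_Rn R n, forall x, Q x}.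
Proof.
have F : Filter (almost_everywhere (completed_lebesgue_Rn R n)).
  exact: ae_filter_ringOfSetsType.
by move=> PQ; apply: (@filterS _ _ F).
Qed.

Lemma ae_completedI n (P Q : n.-tuple R -> Prop) :
  {ae completed_lebesgue_Rn R n, forall x, P x} ->
  {ae completed_lebesgue_Rn R n, forall x, Q x} ->
  {ae completed_lebesgue_Rn R n, forall x, P x /\ Q x}.
Proof.
have F : Filter (almost_everywhere (completed_lebesgue_Rn R n)).
  exact: ae_filter_ringOfSetsType.
by move=> aeP aeQ; apply: (@filterS2 _ _ F _ _ _ _ aeP aeQ).
Qed.

End lebesgue_products.

(** * Dyadic cells *)

Section dyadic_cells.
Context {R : realType} {n : nat}.
Variables (a b : n.-tuple R).
Hypothesis ab : forall i, tnth a i < tnth b i.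
Local Notation w i := (tnth b i - tnth a i).
Local Notation index := {ffun 'I_n -> nat}.
Local Notation mu := (completed_lebesgue_Rn R n).
Local Notation pointset := (set (lebesgue_type R n)).

Let w_gt0 i : 0 < w i. Proof. by rewrite subr_gt0. Qed.

Definition unit_coord (x : n.-tuple R) i : R := (tnth x i - tnth a i) / w i.

(** The position of [x] on axis [i] measured in sides of level [k] cells: its
    integer part is the index of the cell. *)
Definition scaled_coord k x i : R := 2 ^+ k * unit_coord x i.

(** Half-open cells, so that the cells of one level are disjoint and each one is
    the disjoint union of its children. *)
Definition cell k (j : index) : set (n.-tuple R) :=
  [set x | forall i, (j i)%:R <= scaled_coord k x i < (j i).+1%:R].

Definition root_cell := cell 0 [ffun=> 0%N].

Definition cell_index k x : index := [ffun i => Num.truncn (scaled_coord k x i)].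

Definition in_root k (j : index) := [forall i, (j i < 2 ^ k)%N].

Definition cell_volume k : R := \prod_(i < n) (w i / 2 ^+ k).

Definition child (j : index) (e : {ffun 'I_n -> bool}) : index :=
  [ffun i => (j i).*2 + e i]%N.

Definition level_index k (j : {ffun 'I_n -> 'I_(2 ^ k)}) : index :=
  [ffun i => j i : nat].

Lemma level_index_inj k : injective (@level_index k).
Proof.
move=> j j' /ffunP jj'; apply/ffunP => i; apply/val_inj.
by have := jj' i; rewrite !ffunE.
Qed.

Lemma level_indexP k j : in_root k j -> exists j', j = @level_index k j'.
Proof.
move=> /forallP jk; exists [ffun i => Ordinal (jk i)].
by apply/ffunP => i; rewrite !ffunE.
Qed.

Lemma cell_volume_gt0 k : 0 < cell_volume k.
Proof. by apply: prodr_gt0 => i _; rewrite divr_gt0 ?exprn_gt0. Qed.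

Lemma cell_volumeS k : cell_volume k = 2 ^+ n * cell_volume k.+1.
Proof.
rewrite /cell_volume -[in 2 ^+ n](card_ord n) -prodr_const -big_split /=.
by apply: eq_bigr => i _; rewrite exprS invfM mulrCA [2 * _]mulrA divff ?mul1r.
Qed.

Lemma unit_coord_root x i : root_cell x -> 0 <= unit_coord x i < 1.
Proof. by move=> /(_ i); rewrite ffunE /scaled_coord expr0 mul1r. Qed.

Lemma scaled_coord_ge0 k x i : root_cell x -> 0 <= scaled_coord k x i.
Proof.
move=> /(unit_coord_root i)/andP[x0 _].
by rewrite mulr_ge0 // exprn_ge0.
Qed.

Lemma scaled_coordD k l x i :
  scaled_coord (k + l) x i = 2 ^+ k * scaled_coord l x i.
Proof. by rewrite /scaled_coord exprD mulrA. Qed.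

Lemma mem_cell_index k x : root_cell x -> cell k (cell_index k x) x.
Proof. by move=> x0 i; rewrite ffunE truncn_itv // scaled_coord_ge0. Qed.

Lemma cell_indexE k j x : cell k j x -> cell_index k x = j.
Proof. by move=> xj; apply/ffunP => i; rewrite ffunE; exact: truncn_def. Qed.

Lemma in_root_cell_index k x : root_cell x -> in_root k (cell_index k x).
Proof.
move=> x0; apply/forallP => i; have /andP[+ _] := mem_cell_index k x0 i.
have /andP[_ x1] := unit_coord_root i x0.
rewrite -(ltr_nat R) natrX => /le_lt_trans; apply.
by rewrite /scaled_coord gtr_pMr ?exprn_gt0.
Qed.

Lemma cell_sub_root k j x : in_root k j -> cell k j x -> root_cell x.
Proof.
move=> /forallP jk xj i; rewrite ffunE /scaled_coord expr0 mul1r.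
have /andP[x1 x2] := xj i; apply/andP; split.
  have : 0 <= scaled_coord k x i by apply: le_trans x1; rewrite ler0n.
  by rewrite pmulr_rge0 // exprn_gt0.
have : scaled_coord k x i < 2 ^+ k.
  by apply: (lt_le_trans x2); rewrite -natrX ler_nat.
by rewrite /scaled_coord gtr_pMr // exprn_gt0.
Qed.

Lemma cell_index_div k l x i : root_cell x ->
  cell_index l x i = (cell_index (k + l) x i %/ 2 ^ k)%N.
Proof.
move=> x0; rewrite ffunE; apply: truncn_def.
have := mem_cell_index (k + l) x0 i.
set c := cell_index _ _ _; rewrite scaled_coordD => /andP[x1 x2].
have k0 : 0 < 2 ^+ k :> R by rewrite exprn_gt0.
apply/andP; split.
  rewrite -(ler_pM2l k0); apply: le_trans x1.
  by rewrite -natrX -natrM ler_nat mulnC leq_divM.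
rewrite -(ltr_pM2l k0); apply: (lt_le_trans x2).
by rewrite -natrX -natrM ler_nat mulnC ltn_ceil // expn_gt0.
Qed.

Lemma cell_index_child k x : root_cell x ->
  exists e, cell_index k.+1 x = child (cell_index k x) e.
Proof.
move=> x0; exists [ffun i => odd (cell_index k.+1 x i)]; apply/ffunP => i.
rewrite [RHS]ffunE (cell_index_div 1 k) // add1n expn1.
by rewrite [in X in (_ + X)%N]ffunE divn2 addnC odd_double_half.
Qed.

Lemma in_root_child k j e : in_root k j -> in_root k.+1 (child j e).
Proof.
move=> /forallP jk; apply/forallP => i; rewrite ffunE expnS.
by have := jk i; case: (e i) => /=; lia.
Qed.

Let side k (lo hi : 'I_n -> R) i : set (measurableTypeR R) :=
  [set` `[tnth a i + w i / 2 ^+ k * lo i, tnth a i + w i / 2 ^+ k * hi i[].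

Let measurable_side k lo hi i : measurable (side k lo hi i).
Proof. exact: measurable_itv. Qed.

Let dyadic_box_prod k (lo hi : 'I_n -> R) :
  [set x | forall i, lo i <= scaled_coord k x i < hi i] =
  [set x | forall i, side k lo hi i (tnth x i)].
Proof.
have wk i : 0 < w i / 2 ^+ k by rewrite divr_gt0 ?exprn_gt0.
have xE x i : tnth x i = tnth a i + w i / 2 ^+ k * scaled_coord k x i.
  rewrite /scaled_coord /unit_coord; field.
  by rewrite expf_neq0 //= lt0r_neq0.
apply/seteqP; split=> x /= h i; have := h i; rewrite /side /= in_itv /= (xE x).
  by rewrite lerD2l ltrD2l ler_pM2l // ltr_pM2l.
by rewrite lerD2l ltrD2l ler_pM2l // ltr_pM2l.
Qed.

Lemma measurable_dyadic_box k (lo hi : 'I_n -> R) :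
  measurable ([set x | forall i, lo i <= scaled_coord k x i < hi i] : pointset).
Proof.
rewrite dyadic_box_prod; apply: measurable_completed.
exact: measurable_tuple_prod (measurable_side k lo hi).
Qed.

Lemma measure_dyadic_box k (lo hi : 'I_n -> R) : (forall i, lo i <= hi i) ->
  mu [set x | forall i, lo i <= scaled_coord k x i < hi i] =
  (cell_volume k * \prod_(i < n) (hi i - lo i))%:E.
Proof.
move=> lohi.
have mside := measurable_side k lo hi.
rewrite dyadic_box_prod completed_lebesgue_RnE; last first.
  exact: measurable_tuple_prod mside.
rewrite (lebesgue_Rn_prod mside) -big_split /= -prodEFin; apply: eq_bigr => i _.
rewrite /side lebesgue_measure_itv /= lte_fin.
have wk : 0 < w i / 2 ^+ k by rewrite divr_gt0 ?exprn_gt0.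
rewrite ltrD2l ltr_pM2l //; case: ltP => [_|hilo].
  by rewrite -EFinB; congr (_%:E); ring.
by have -> : hi i = lo i; [apply/eqP; rewrite eq_le hilo lohi | rewrite subrr mulr0].
Qed.

Lemma measurable_cell k j : measurable (cell k j : pointset).
Proof. exact: measurable_dyadic_box. Qed.

Lemma measure_cell k j : mu (cell k j) = (cell_volume k)%:E.
Proof.
rewrite /cell (measure_dyadic_box k (fun i => _)) => [|i]; last by rewrite ler_nat.
by rewrite big1 ?mulr1 // => i _; rewrite -[(j i).+1%:R]natr1 addrC addKr.
Qed.

(** Whether [x] in the root cell satisfies a condition on its level [k] index
    is decided by countably many cells. *)
Lemma measurable_cell_index k (P : set index) :
  measurable ([set x | root_cell x /\ P (cell_index k x)] : pointset).
Proof.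
rewrite (_ : [set x | _] = root_cell `&`
    \bigcup_(j : index) (if `[< P j >] then cell k j else set0)).
  apply: measurableI; first exact: measurable_cell.
  apply: countable_bigcupT_measurable => [|j]; first exact: countableP.
  by case: ifP => // _; exact: measurable_cell.
apply/seteqP; split=> x /= [x0 h]; split=> //.
  by exists (cell_index k x) => //; case: asboolP => // _; exact: mem_cell_index.
by case: h => j _; case: asboolP => // Pj /cell_indexE ->.
Qed.

End dyadic_cells.

Section finite_unions.
Context d (T : measurableType d) (R : realType) (mu : {measure set T -> \bar R}).
Local Open Scope ereal_scope.

Lemma mem_bigsetU (I : eqType) (r : seq I) (P : pred I) (B : I -> set T) x :
  (\big[setU/set0]_(i <- r | P i) B i) x <-> exists i, [/\ i \in r, P i & B i x].
Proof.
elim: r => [|i r IH]; first by rewrite big_nil; split => // -[? []].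
rewrite big_cons; case: ifP => Pi; split.
- move=> [Bi|/IH[j [jr Pj Bj]]]; first by exists i; rewrite mem_head.
  by exists j; rewrite inE jr orbT.
- move=> [j [+ Pj Bj]]; rewrite inE => /orP[/eqP <-|jr]; first by left.
  by right; apply/IH; exists j.
- by move=> /IH[j [jr Pj Bj]]; exists j; rewrite inE jr orbT.
- move=> [j [+ Pj Bj]]; rewrite inE => /orP[/eqP ji|jr]; first by rewrite -ji Pj in Pi.
  by apply/IH; exists j.
Qed.

Lemma measurable_bigsetU (I : Type) (r : seq I) (P : pred I) (B : I -> set T) :
  (forall i, measurable (B i)) ->
  measurable (\big[setU/set0]_(i <- r | P i) B i).
Proof. by move=> mB; apply: bigsetU_measurable => i _. Qed.

Lemma measure_bigsetU_le (I : Type) (r : seq I) (P : pred I) (B : I -> set T) :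
  (forall i, measurable (B i)) ->
  mu (\big[setU/set0]_(i <- r | P i) B i) <= \sum_(i <- r | P i) mu (B i).
Proof.
move=> mB; elim: r => [|i r IH]; first by rewrite !big_nil measure0.
rewrite !big_cons; case: ifP => // _; apply: le_trans (leeD2l _ IH).
by apply: measureU2 => //; exact: measurable_bigsetU.
Qed.

Lemma measure_bigsetU_disjoint (I : eqType) (r : seq I) (P : pred I)
    (B : I -> set T) : uniq r ->
  (forall i, measurable (B i)) ->
  (forall i j x, B i x -> B j x -> i = j) ->
  mu (\big[setU/set0]_(i <- r | P i) B i) = \sum_(i <- r | P i) mu (B i).
Proof.
move=> + mB dB; elim: r => [|i r IH]; first by rewrite !big_nil measure0.
move=> /= /andP[ir ur]; rewrite !big_cons; case: ifP => _; last exact: IH.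
rewrite measureU //; [by congr (_ + _); exact: IH | exact: measurable_bigsetU |].
rewrite -subset0 => x [Bi /mem_bigsetU[j [jr _ Bj]]].
by rewrite (dB _ _ _ Bi Bj) jr in ir.
Qed.

End finite_unions.

(** * Almost everywhere convergence of superadditive cell functions *)

Section crossing_potential.
Context {R : realType}.
Variables (p q : R).
Hypothesis p0 : 0 < p.
Hypothesis pq : p < q.

Let q0 : 0 < q. Proof. exact: lt_trans pq. Qed.

(** [s] counts the half-crossings still to be made: an even [s] waits for a
    value below [p], an odd [s] for a value above [q]. *)
Definition crossing_step (s : nat) (v : R) : nat :=
  if odd s then (if q < v then s.-1 else s) else (if v < p then s.-1 else s).

(** Dubins' bound for the proportion of a cell of ratio [v] on which the [s]
    remaining half-crossings are made.  It is nondecreasing and concave in [v],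
    so it averages well over the children of a cell, and it does not increase
    when a half-crossing is made. *)
Definition crossing_potential (s : nat) (v : R) : R :=
  if s is 0%N then 1
  else (p / q) ^+ s./2 * Num.min (v / (if odd s then q else p)) 1.

Let pq_ge0 : 0 <= p / q. Proof. by rewrite divr_ge0 // ltW. Qed.

Lemma crossing_step0 v : crossing_step 0 v = 0%N.
Proof. by rewrite /crossing_step /=; case: ifP. Qed.

Lemma crossing_step_le s v : (crossing_step s v <= s)%N.
Proof. by rewrite /crossing_step; do 2 case: ifP => _ //; rewrite leq_pred. Qed.

Lemma crossing_potential_ge0 s v : 0 <= v -> 0 <= crossing_potential s v.
Proof.
case: s => // s v0; rewrite /crossing_potential mulr_ge0 ?exprn_ge0 //.
by rewrite le_min ler01 andbT divr_ge0 //; case: ifP => _; exact: ltW.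
Qed.

Lemma crossing_potential_le s v : crossing_potential s v <= (p / q) ^+ s./2.
Proof.
case: s => [|s]; first by rewrite /= expr0.
by rewrite /crossing_potential ler_piMr ?exprn_ge0 // ge_min lexx orbT.
Qed.

(** At a switch the two potentials meet: min(v/p, 1) = v/p when v < p, and
    (p/q) (v/p) = v/q is at least the next potential; likewise min(v/q, 1) = 1
    when q < v. *)
Lemma crossing_potential_step s v :
  crossing_potential (crossing_step s v) v <= crossing_potential s v.
Proof.
case: s => [|s]; first by rewrite crossing_step0.
rewrite /crossing_step; case: (boolP (odd s.+1)) => os; case: ifP => // h.
  apply: le_trans (crossing_potential_le _ _) _.
  rewrite /crossing_potential os min_r ?mulr1; last first.
    by rewrite ler_pdivlMr // mul1r ltW.
  by move: os => /= /negPf os; rewrite uphalf_half os.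
have {}os : odd s by move: os; rewrite /= negbK.
have -> : crossing_potential s.+1 v = (p / q) ^+ s./2 * (v / q).
  rewrite /crossing_potential /= os /= uphalf_half os add1n exprSr -mulrA.
  rewrite min_l; last by rewrite ler_pdivrMr // mul1r ltW.
  by congr (_ * _); field; rewrite !lt0r_neq0.
case: s os {h} => // s os; rewrite /crossing_potential os.
by rewrite ler_wpM2l ?exprn_ge0 // ge_min lexx.
Qed.

(** Jensen's inequality for v |-> min(v/t, 1), which only needs the two bounds
    v/t and 1. *)
Lemma crossing_potential_sum (E : finType) s (v : R) (u : E -> R) :
  \sum_e u e <= #|E|%:R * v ->
  \sum_e crossing_potential s (u e) <= #|E|%:R * crossing_potential s v.
Proof.
have le1 (c : E -> R) : (forall e, c e <= 1) -> \sum_e c e <= #|E|%:R.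
  by move=> c1; rewrite -sumr_const; exact: ler_sum.
move=> uv; case: s => [|s]; first by rewrite mulr1; exact: le1.
rewrite /crossing_potential -mulr_sumr mulrCA ler_wpM2l ?exprn_ge0 //.
set t := if _ then _ else _; have t0 : 0 < t by rewrite /t; case: ifP.
have [vt|_] := leP (v / t) 1; last first.
  by rewrite mulr1; apply: le1 => e; rewrite ge_min lexx orbT.
apply: (@le_trans _ _ (\sum_e u e / t)).
  by apply: ler_sum => e _; rewrite ge_min lexx.
by rewrite -mulr_suml mulrA ler_wpM2r // invr_ge0 ltW.
Qed.

End crossing_potential.

Lemma ae_forall_count d (T : measurableType d) (R : realType)
    (mu : {measure set T -> \bar R}) (I : countType) (P : I -> T -> Prop) :
  (forall i, {ae mu, forall x, P i x}) -> {ae mu, forall x, forall i, P i x}.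
Proof.
move=> aeP.
have : {ae mu, forall x, forall k, if unpickle k is Some i then P i x else True}.
  by apply: ae_foralln => k; case: unpickle => [i|]; [exact: aeP | exact: aeW].
by apply: filterS => x xP i; have := xP (pickle i); rewrite pickleK.
Qed.

Section bounded_crossings.
Context {R : realType}.

(** The limit is the supremum of the eventual lower bounds of [u]: across a
    rational band just above it, [u] can only end up below. *)
Lemma cvg_of_bounded_crossings (u : nat -> R) (B : R) :
  (forall k, 0 <= u k <= B) ->
  (forall p q : rat, 0 < p -> p < q -> exists K,
     (forall l, (K <= l)%N -> u l <= ratr q) \/
     (forall l, (K <= l)%N -> ratr p <= u l)) ->
  cvg (u k @[k --> \oo]).
Proof.
move=> uB cross.
pose A := [set r : R | exists K, forall l, (K <= l)%N -> r <= u l].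
have A0 : A 0 by exists 0%N => l _; have /andP[] := uB l.
have supA : has_sup A.
  split; [by exists 0 | exists B => r [K rK]].
  by apply: le_trans (rK K (leqnn K)) _; have /andP[] := uB K.
have D0 : 0 <= sup A by apply: ub_le_sup => //; case: supA.
apply/cvg_ex; exists (sup A); apply/cvgrPdist_le => e e0.
have [r [K1 rK] er] := sup_adherent e0 supA.
have [q qe] : exists q : rat, sup A < ratr q < sup A + e.
  have [|q] := @rat_in_itvoo _ (sup A) (sup A + e); first by rewrite ltrDl.
  by rewrite in_itv; exists q.
have /andP[Dq qe'] := qe.
have [p] := rat_in_itvoo Dq; rewrite in_itv /= => /andP[Dp pq].
have p0 : 0 < p by rewrite -(ltr0q R); exact: le_lt_trans Dp.
have {}pq : p < q by rewrite -(ltr_rat R).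
have [K2 [Kq|Kp]] := cross p q p0 pq; last first.
  have : ratr p <= sup A by apply: ub_le_sup; [case: supA | exists K2].
  by rewrite leNgt Dp.
exists (maxn K1 K2) => // l /=; rewrite geq_max => /andP[K1l K2l].
by rewrite ler_distl; have := Kq l K2l; have := rK l K1l; lra.
Qed.

End bounded_crossings.

Section upcrossing.
Context {R : realType} {n : nat}.
Variables (a b : n.-tuple R).
Hypothesis ab : forall i, tnth a i < tnth b i.
Local Notation index := {ffun 'I_n -> nat}.
Local Notation mu := (completed_lebesgue_Rn R n).
Local Notation pointset := (set (lebesgue_type R n)).

Variable G : nat -> index -> R.
Hypothesis G_ge0 : forall k j, in_root k j -> 0 <= G k j.
Hypothesis G_super : forall k j, in_root k j -> \sum_e G k.+1 (child j e) <= G k j.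

Definition cell_ratio k j := G k j / cell_volume a b k.

Definition ratio_at k (x : n.-tuple R) := cell_ratio k (cell_index a b k x).

Lemma cell_ratio_ge0 k j : in_root k j -> 0 <= cell_ratio k j.
Proof. by move=> /G_ge0 Gk; rewrite divr_ge0 // ltW // cell_volume_gt0. Qed.

(** The number of half-crossings still to be made after [r] further levels, for
    the path of [x] started at level [k] with [s] of them to make. *)
Fixpoint crossing_state p q k s r (x : n.-tuple R) : nat :=
  if r is r'.+1 then
    crossing_state p q k.+1 (crossing_step p q s (ratio_at k.+1 x)) r' x
  else s.

Lemma crossing_state_add p q k s r r' x :
  crossing_state p q k s (r + r') x =
  crossing_state p q (k + r) (crossing_state p q k s r x) r' x.
Proof.
elim: r k s => [|r IH] k s; first by rewrite addn0.
by rewrite addSn /= IH addSnnS.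
Qed.

Lemma crossing_state0 p q k r x : crossing_state p q k 0 r x = 0%N.
Proof. by elim: r k => //= r IH k; rewrite crossing_step0. Qed.

Lemma crossing_state_le p q k s r x : (crossing_state p q k s r x <= s)%N.
Proof.
elim: r k s => //= r IH k s; apply: leq_trans (IH _ _) _.
exact: crossing_step_le.
Qed.

Lemma measurable_crossing_state p q k s r (j : nat) : measurable
  ([set x | root_cell a b x /\ crossing_state p q k s r x = j] : pointset).
Proof.
elim: r k s => [|r IH] k s.
  rewrite (_ : [set x | _] = if s == j then root_cell a b else set0); last first.
    by apply/seteqP; split=> x /=; case: eqP => [->//|sj] []//.
  by case: ifP => // _; exact: measurable_cell.
rewrite (_ : [set x | _] = \bigcup_s'
  ([set x | root_cell a b x /\
     crossing_step p q s (cell_ratio k.+1 (cell_index a b k.+1 x)) = s'] `&`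
   [set x | root_cell a b x /\ crossing_state p q k.+1 s' r x = j])); last first.
  apply/seteqP; split=> x /=.
    by move=> [x0 xj]; exists (crossing_step p q s (ratio_at k.+1 x)).
  by move=> [s' _ /= [[x0 <-] [_ xj]]].
apply: bigcup_measurable => s' _; apply: measurableI => //.
apply: (measurable_cell_index ab k.+1
  (fun i => crossing_step p q s (cell_ratio k.+1 i) = s')) => //.
Qed.

Section one_band.
Variables (p q : R).
Hypotheses (p0 : 0 < p) (pq : p < q).

Let state := crossing_state p q.
Let potential := crossing_potential p q.

(** Dubins' inequality, by induction on the horizon: the cell splits into its
    children, the potential averages over them, and [G_super] says that the
    ratio is a supermartingale. *)
Lemma measure_crossing k j s r : in_root k j ->
  (mu [set x | cell a b k j x /\ state k s r x = 0%N] <=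
   (cell_volume a b k * potential s (cell_ratio k j))%:E)%E.
Proof.
have mst k' j' s' r' : measurable
    ([set x | cell a b k' j' x /\ (root_cell a b x /\ state k' s' r' x = 0%N)] : pointset).
  by apply: measurableI; [exact: measurable_cell | exact: measurable_crossing_state].
have stE k' j' s' r' : in_root k' j' ->
    [set x | cell a b k' j' x /\ state k' s' r' x = 0%N] =
    [set x | cell a b k' j' x /\ (root_cell a b x /\ state k' s' r' x = 0%N)].
  move=> jk'; apply/seteqP; split=> x /= [xj]; last by case.
  by split=> //; split=> //; exact: cell_sub_root xj.
elim: r k j s => [|r IH] k j s jk.
  rewrite stE //; have vol0 := ltW (cell_volume_gt0 ab k).
  have [->|s0] := eqVneq s 0%N.
    rewrite [potential _ _]/= mulr1 -(measure_cell ab k j).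
    apply: le_measure; rewrite ?inE //=; first exact: measurable_cell.
    by move=> x [].
  rewrite (_ : [set x | _] = set0) ?measure0.
    by rewrite lee_fin mulr_ge0 // crossing_potential_ge0 // cell_ratio_ge0.
  by apply/seteqP; split=> x //= [_ [_ /eqP]]; rewrite (negPf s0).
pose s' e := crossing_step p q s (cell_ratio k.+1 (child j e)).
pose B e := [set x | cell a b k.+1 (child j e) x /\ state k.+1 (s' e) r x = 0%N].
have mB e : measurable (B e : pointset).
  by rewrite /B stE ?in_root_child.
apply: (@le_trans _ _ (mu (\big[setU/set0]_(e : {ffun 'I_n -> bool}) B e))).
  apply: le_measure; rewrite ?inE; [by rewrite stE | exact: measurable_bigsetU |].
  move=> x [xj xs]; have x0 := cell_sub_root jk xj.
  have [e xe] := cell_index_child k x0.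
  rewrite (cell_indexE xj) in xe.
  apply/mem_bigsetU; exists e; split; rewrite ?mem_index_enum // /B.
  split; first by rewrite -xe; exact: mem_cell_index.
  by move: xs; rewrite /state /= /s' /ratio_at xe.
apply: le_trans (measure_bigsetU_le _ _ _ mB) _.
apply: (@le_trans _ _ (\sum_(e : {ffun 'I_n -> bool}) (cell_volume a b k.+1 *
    potential s (cell_ratio k.+1 (child j e)))%:E)%E).
  apply: lee_sum => e _; apply: le_trans (IH _ _ _ (in_root_child e jk)) _.
  rewrite lee_fin ler_wpM2l ?(ltW (cell_volume_gt0 ab _)) //.
  exact: crossing_potential_step.
have vol1 := cell_volume_gt0 ab k.+1.
rewrite sumEFin lee_fin -mulr_sumr (cell_volumeS _ _ k) (mulrC (2 ^+ n)) -mulrA ler_pM2l //.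
have card2 : #|{ffun 'I_n -> bool}|%:R = 2 ^+ n :> R.
  by rewrite card_ffun card_bool card_ord natrX.
rewrite -card2; apply: crossing_potential_sum => //.
rewrite card2 /cell_ratio -mulr_suml (cell_volumeS _ _ k).
rewrite ler_pdivrMr //; have := G_super jk; congr (_ <= _).
by field; rewrite expf_neq0 ?lt0r_neq0.
Qed.

Lemma measure_crossing_root s :
  (mu [set x | root_cell a b x /\ exists r, state 0 s r x = 0%N] <=
   (cell_volume a b 0 * potential s (cell_ratio 0 [ffun=> 0%N]))%:E)%E.
Proof.
pose F r := [set x | root_cell a b x /\ state 0 s r x = 0%N].
have mF r : measurable (F r : pointset) by exact: measurable_crossing_state.
rewrite (_ : [set x | _] = \bigcup_r F r); last first.
  apply/seteqP; split=> x /=; first by move=> [x0 [r xr]]; exists r.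
  by move=> [r _ [x0 xr]]; split=> //; exists r.
have cvF : (mu (F r) @[r --> \oo] --> mu (\bigcup_r F r))%E.
  apply: nondecreasing_cvg_mu => //; first exact: bigcupT_measurable.
  move=> r r' rr'; apply/subsetPset => x [x0 xr]; split=> //.
  rewrite /state -(subnKC rr') crossing_state_add.
  by rewrite [X in crossing_state _ _ _ X]xr crossing_state0.
rewrite -(cvg_lim _ cvF) //; apply: lime_le; first exact: cvgP cvF.
apply: nearW => r; apply: measure_crossing.
by apply/forallP => i; rewrite ffunE.
Qed.

End one_band.

(** Each additional upcrossing multiplies the measure by at most [p / q]. *)
Lemma ae_finitely_many_crossings p q : 0 < p -> p < q ->
  {ae mu, forall x, root_cell a b x ->
     exists s, forall r, crossing_state p q 0 s r x <> 0%N}.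
Proof.
move=> p0 pq.
pose U s := [set x | root_cell a b x /\ exists r, crossing_state p q 0 s r x = 0%N].
have mU s : measurable (U s : pointset).
  rewrite (_ : U s = \bigcup_r [set x | root_cell a b x /\ crossing_state p q 0 s r x = 0%N]).
    by apply: bigcupT_measurable => r; exact: measurable_crossing_state.
  apply/seteqP; split=> x /=; first by move=> [x0 [r xr]]; exists r.
  by move=> [r _ [x0 xr]]; split=> //; exists r.
exists (\bigcap_s U s); split.
- exact: bigcapT_measurable.
- apply/eqP; rewrite eq_le measure_ge0 andbT; apply/lee_addgt0Pr => e e0.
  rewrite add0e.
  have th1 : `|p / q| < 1.
    rewrite ger0_norm ?divr_ge0 ?(ltW (lt_trans _ pq)) ?(ltW p0) //.
    by rewrite ltr_pdivrMr ?mul1r // (lt_trans p0).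
  have vol0 := cell_volume_gt0 ab 0.
  have : (p / q) ^+ m @[m --> \oo] --> (0 : R) by exact: cvg_expr.
  move=> /cvgrPdist_lt /(_ (e / cell_volume a b 0)) []; first by rewrite divr_gt0.
  move=> m _ /(_ m (leqnn m)); rewrite sub0r normrN => small.
  have US : (mu (\bigcap_s U s) <= mu (U m.*2))%E.
    apply: le_measure; rewrite ?inE //; first exact: bigcapT_measurable.
    by move=> x; apply.
  apply: (le_trans US); apply: le_trans (measure_crossing_root p0 pq _) _.
  rewrite lee_fin -ler_pdivlMl // [leRHS]mulrC.
  apply: le_trans (crossing_potential_le p0 pq _ _) _.
  by rewrite doubleK; apply: le_trans (ltW small); rewrite ler_norm.
- move=> x /= /not_implyP[x0 /forallNP xs] s _; split=> //.
  by have /existsNP[r /contrapT xr] := xs s; exists r.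
Qed.

(** The state never increases, so it is eventually constant; its parity tells on
    which side of the band the ratio stays. *)
Lemma one_sided_of_crossings p q x s k :
  (forall r, crossing_state p q k s r x <> 0%N) ->
  exists K, (forall l, (K <= l)%N -> ratio_at l x <= q) \/
            (forall l, (K <= l)%N -> p <= ratio_at l x).
Proof.
elim/ltn_ind: s k => s IH k xs.
have [[r sr]|] := pselect (exists r, (crossing_state p q k s r x < s)%N).
  by apply: (IH _ sr (k + r)%N) => r'; rewrite -crossing_state_add.
move=> /forallNP stay.
have {}stay r : crossing_state p q k s r x = s.
  apply/eqP; rewrite eqn_leq crossing_state_le leqNgt; exact/negP.
have s0 : (0 < s)%N by rewrite lt0n; apply/eqP; exact: (xs 0%N).
have stepE l : (k < l)%N -> crossing_step p q s (ratio_at l x) = s.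
  move=> kl; have := stay (l - k)%N.
  rewrite -[X in crossing_state _ _ _ _ X](subnK (_ : 1 <= l - k)%N) ?subn_gt0 //.
  rewrite crossing_state_add stay /=.
  by have -> : (k + (l - k - 1)).+1 = l by lia.
exists k.+1; case: (boolP (odd s)) => os; [left|right] => l kl;
  have := stepE l kl; rewrite /crossing_step ?os ?(negPf os).
  by case: ltP => // _; case: s s0 {IH xs stay stepE os} => //= s _ /eqP; lia.
by case: ltP => // _; case: s s0 {IH xs stay stepE os} => //= s _ /eqP; lia.
Qed.

(** The maximal inequality: exceeding [q] from the start is the one half-crossing
    [s = 1], whose potential is at most [cell_ratio 0 _ / q]. *)
Lemma ae_cell_ratio_bounded :
  {ae mu, forall x, root_cell a b x -> exists B, forall k, ratio_at k x <= B}.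
Proof.
pose q (m : nat) : R := m.+1%:R.
have q0 m : 0 < q m by rewrite ltr0n.
have p0 m : 0 < q m / 2 by rewrite divr_gt0.
have pq m : q m / 2 < q m by rewrite ltr_pdivrMr // ltr_pMr ?ltr1n.
pose state m := crossing_state (q m / 2) (q m) 0 1.
pose U m := [set x | root_cell a b x /\ exists r, state m r x = 0%N].
have mU m : measurable (U m : pointset).
  rewrite (_ : U m = \bigcup_r [set x | root_cell a b x /\ state m r x = 0%N]).
    by apply: bigcupT_measurable => r; exact: measurable_crossing_state.
  apply/seteqP; split=> x /=; first by move=> [x0 [r xr]]; exists r.
  by move=> [r _ [x0 xr]]; split=> //; exists r.
exists (\bigcap_m U m); split.
- exact: bigcapT_measurable.
- apply/eqP; rewrite eq_le measure_ge0 andbT; apply/lee_addgt0Pr => e e0.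
  rewrite add0e; have vol0 := cell_volume_gt0 ab 0.
  set g0 := cell_ratio 0 [ffun=> 0%N].
  have [m mbig] : exists m, cell_volume a b 0 * g0 / e < q m.
    exists (Num.truncn (cell_volume a b 0 * g0 / e)); exact: truncnS_gt.
  have US : (mu (\bigcap_s U s) <= mu (U m))%E.
    apply: le_measure; rewrite ?inE //; first exact: bigcapT_measurable.
    by move=> x; apply.
  apply: (le_trans US); apply: le_trans (measure_crossing_root (p0 m) (pq m) _) _.
  rewrite lee_fin /crossing_potential /= expr0 mul1r.
  apply: (@le_trans _ _ (cell_volume a b 0 * (g0 / q m))).
    by rewrite ler_pM2l // ge_min lexx.
  by rewrite mulrA ler_pdivrMr // [leRHS]mulrC -ler_pdivrMr // ltW.
- move=> x /= /not_implyP[x0 /forallNP xB] m _; split=> //.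
  apply: contrapT => /forallNP xm.
  apply: (xB (Num.max (q m) (ratio_at 0 x))) => -[|k]; first by rewrite le_max lexx orbT.
  have st1 r : state m r x = 1%N.
    apply/eqP; rewrite eqn_leq crossing_state_le lt0n; apply/eqP; exact: xm.
  have := st1 (k + 1)%N; rewrite /state crossing_state_add.
  rewrite -/(state m k x) st1 /= /crossing_step /= add0n.
  by rewrite le_max; case: (ltP (q m)) => // ->.
Qed.

(** The supermartingale convergence theorem, for dyadic cell functions. *)
Lemma ae_cvg_cell_ratio : {ae mu, forall x, root_cell a b x ->
  cvg (ratio_at k x @[k --> \oo])}.
Proof.
have ae_band : {ae mu, forall x (pq : rat * rat), root_cell a b x ->
    0 < pq.1 -> pq.1 < pq.2 ->
    exists s, forall r, crossing_state (ratr pq.1) (ratr pq.2) 0 s r x <> 0%N}.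
  apply: ae_forall_count => -[p q].
  have [/andP[p0 pq]|npq] := boolP ((0 < p) && (p < q)); last first.
    by apply: aeW => x _ /= p0 pq; rewrite p0 pq in npq.
  have := @ae_finitely_many_crossings (ratr p) (ratr q).
  rewrite ltr0q ltr_rat => /(_ p0 pq); apply: ae_completedS => x xs x0 _ _; exact: xs.
apply: ae_completedS (ae_completedI ae_band ae_cell_ratio_bounded).
move=> x [xpq xB] x0.
have [B xleB] := xB x0; apply: (@cvg_of_bounded_crossings _ _ B).
  move=> k; rewrite xleB andbT cell_ratio_ge0 //.
  exact: in_root_cell_index.
move=> p q p0 pq; have [s xs] := xpq (p, q) x0 p0 pq.
by have [K] := one_sided_of_crossings xs; exists K.
Qed.

End upcrossing.

(** * From the cells of a point to the neighbouring cells *)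

Section near_cells.
Context {R : realType} {n : nat}.
Variables (a b : n.-tuple R).
Hypothesis ab : forall i, tnth a i < tnth b i.
Local Notation index := {ffun 'I_n -> nat}.
Local Notation mu := (completed_lebesgue_Rn R n).
Local Notation pointset := (set (lebesgue_type R n)).

Definition ancestor (t : nat) (j : index) : index := [ffun i => j i %/ 2 ^ t]%N.

Definition shift_index (j : index) (v : 'I_n -> nat) : index :=
  [ffun i => j i + v i]%N.

Lemma ancestor_add t t' j : ancestor t' (ancestor t j) = ancestor (t + t') j.
Proof. by apply/ffunP => i; rewrite !ffunE -divnMA expnD. Qed.

Lemma in_root_ancestor t l j : in_root (t + l) j -> in_root l (ancestor t j).
Proof.
move=> /forallP jt; apply/forallP => i; rewrite ffunE ltn_divLR ?expn_gt0 //.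
by rewrite -expnD addnC.
Qed.

Lemma ancestor_cell_index t l x : root_cell a b x ->
  ancestor t (cell_index a b (t + l) x) = cell_index a b l x.
Proof.
by move=> x0; apply/ffunP => i; rewrite [LHS]ffunE -cell_index_div.
Qed.

Variables (Good : nat -> index -> Prop) (k0 M : nat).

(** The maximal cells, of level at least [k0], without the property [Good]. *)
Definition first_bad l (j : index) :=
  [/\ in_root l j, (k0 <= l)%N, ~ Good l j &
      forall t l', l = (t + l')%N -> (0 < t)%N -> (k0 <= l')%N ->
        Good l' (ancestor t j)].

(** One more step than [M] absorbs the rounding when passing to ancestors. *)
Definition near_index (c j : index) : Prop :=
  forall i, (c i <= j i <= c i + M.+1)%N.

Let bad_set l : pointset :=
  [set x | root_cell a b x /\ first_bad l (cell_index a b l x)].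

Let near_bad_set l : pointset :=
  [set x | root_cell a b x /\
           exists j, first_bad l j /\ near_index (cell_index a b l x) j].

Let measurable_bad_set l : measurable (bad_set l).
Proof. exact: (measurable_cell_index ab l (first_bad l)). Qed.

Let measurable_near_bad_set l : measurable (near_bad_set l).
Proof.
exact: (measurable_cell_index ab l (fun c => exists j, first_bad l j /\ near_index c j)).
Qed.

Let trivIset_bad_set : trivIset setT bad_set.
Proof.
suff disj l l' x : (l < l')%N -> bad_set l x -> bad_set l' x -> False.
  move=> l l' _ _ [x [xl xl']]; case: (ltngtP l l') => // ll'.
    by case: (disj _ _ _ ll' xl xl').
  by case: (disj _ _ _ ll' xl' xl).
move=> ll' [x0 [_ k0l bad _]] [_ [_ _ _ good]]; apply: bad.
rewrite -(ancestor_cell_index (l' - l) l x0) subnK ?(ltnW ll') //.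
by apply: good; rewrite ?subnK ?subn_gt0 // ltnW.
Qed.

(** The points near a given cell form a box of side [M.+2] cells. *)
Let measure_near_bad_set l :
  (mu (near_bad_set l) <= ((M.+2%:R) ^+ n)%:E * mu (bad_set l))%E.
Proof.
pose P (j : {ffun 'I_n -> 'I_(2 ^ l)}) := `[< first_bad l (level_index j) >].
have -> : bad_set l = \big[setU/set0]_(j | P j) cell a b l (level_index j).
  apply/seteqP; split=> x.
    move=> [x0 xbad]; apply/mem_bigsetU.
    have [j xj] := level_indexP (in_root_cell_index l x0).
    exists j; rewrite mem_index_enum /P -xj; split=> //; first exact/asboolP.
    exact: mem_cell_index.
  move=> /mem_bigsetU[j [_ /asboolP jbad xj]].
  split; last by rewrite (cell_indexE xj).
  by case: jbad => jl _ _ _; exact: cell_sub_root xj.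
rewrite measure_bigsetU_disjoint; first last.
- move=> i j x /cell_indexE xi /cell_indexE xj.
  by apply: level_index_inj; rewrite -xi -xj.
- by move=> j; exact: measurable_cell.
- exact: index_enum_uniq.
pose box (j : {ffun 'I_n -> 'I_(2 ^ l)}) := [set x | forall i,
  (level_index j i)%:R - M.+1%:R <= scaled_coord a b l x i
    < (level_index j i).+1%:R] : pointset.
have mbox j : measurable (box j) by exact: measurable_dyadic_box.
apply: (@le_trans _ _ (mu (\big[setU/set0]_(j | P j) box j))).
  apply: le_measure; rewrite ?inE //; first exact: measurable_bigsetU.
  move=> x [x0 [j [jbad xj]]]; apply/mem_bigsetU.
  have [j' jj'] : exists j', j = @level_index n l j' by case: jbad => /level_indexP.
  exists j'; rewrite mem_index_enum /P -jj'; split=> //; first exact/asboolP.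
  move=> i; rewrite -jj'; have /andP[x1 x2] := mem_cell_index l x0 i.
  have /andP[x3 x4] := xj i.
  rewrite lerBlDr (le_trans (_ : _ <= (cell_index a b l x i)%:R + M.+1%:R)) ?lerD2r //=.
    by apply: lt_le_trans x2 _; rewrite ler_nat.
  by rewrite -natrD ler_nat.
apply: le_trans (measure_bigsetU_le _ _ _ mbox) _.
rewrite ge0_sume_distrr; last by move=> *; exact: measure_ge0.
apply: lee_sum => j _; rewrite [X in (_ * X)%E](measure_cell ab l) /box.
rewrite [X in (X <= _)%E](measure_dyadic_box ab l) => [|i]; last first.
  by rewrite lerBlDr -natrD ler_nat; lia.
rewrite -EFinM lee_fin mulrC.
rewrite (eq_bigr (fun=> M.+2%:R)) ?prodr_const ?card_ord // => i _.
by rewrite -!natr1; ring.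
Qed.

(** Cells are half-open, so [x] is at a positive distance from the upper faces
    of its level [L] cell, and fine cells a few steps above that of [x] stay
    inside. *)
Let ancestor_shift_eventually L x : root_cell a b x ->
  exists T, forall t, (T <= t)%N -> forall v, (forall i, (v i <= M)%N) ->
    ancestor t (shift_index (cell_index a b (t + L) x) v) = cell_index a b L x.
Proof.
move=> x0; pose gap i := (cell_index a b L x i).+1%:R - scaled_coord a b L x i.
have gap0 i : 0 < gap i.
  by rewrite subr_gt0; have /andP[] := mem_cell_index L x0 i.
pose T i := (Num.truncn (M%:R / gap i)).+1.
exists (\max_i T i) => t Tt v vM; apply/ffunP => i; rewrite ffunE.
apply/eqP; rewrite eqn_leq; apply/andP; split; last first.
  by rewrite (cell_index_div t) // leq_div2r // [leqRHS]ffunE leq_addr.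
rewrite -ltnS ltn_divLR ?expn_gt0 // -(ltr_nat R) [shift_index _ _ i]ffunE natrD natrM natrX.
have /andP[x1 _] := mem_cell_index (t + L) x0 i.
rewrite scaled_coordD in x1.
have Mgap : M%:R < 2 ^+ t * gap i.
  rewrite -ltr_pdivrMr //; apply: (lt_le_trans (truncnS_gt _)).
  rewrite -natrX ler_nat; apply: leq_trans (leq_trans (leq_bigmax i) Tt) _.
  exact: ltnW (ltn_expl _ _).
have vM' : (v i)%:R <= M%:R :> R by rewrite ler_nat.
by move: Mgap; rewrite /gap mulrBr [2 ^+ t * _.+1%:R]mulrC; lra.
Qed.

(** Let x avoid the upper limit of the near bad sets.  A bad cell close to x has
    a maximal bad ancestor, still close to x, which must then be of level less
    than some [L]; but the ancestors of that cell up to level [L] are those of x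
    itself, and these are good. *)
Lemma ae_near_cells : {ae mu, forall x, root_cell a b x ->
  (forall k, (k0 <= k)%N -> Good k (cell_index a b k x)) ->
  exists K, forall k, (K <= k)%N -> forall v, (forall i, (v i <= M)%N) ->
    in_root k (shift_index (cell_index a b k x) v) ->
    Good k (shift_index (cell_index a b k x) v)}.
Proof.
exists (lim_sup_set near_bad_set); split.
- apply: bigcapT_measurable => m.
  by apply: bigcup_measurable => l _; exact: measurable_near_bad_set.
- apply: lim_sup_set_cvg0 => //.
  apply: (@le_lt_trans _ _ (\sum_(l <oo) ((M.+2%:R) ^+ n)%:E * mu (bad_set l))%E).
    by apply: lee_nneseries => // l _; exact: measure_near_bad_set.
  rewrite nneseriesZl //.
  have <- : (mu (\bigcup_l bad_set l) = \sum_(l <oo) mu (bad_set l))%E.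
    by rewrite measure_bigcup //; apply: eq_eseriesl => l; rewrite in_setT.
  apply: (@le_lt_trans _ _ (((M.+2%:R) ^+ n)%:E * mu (root_cell a b))%E).
    apply: lee_wpmul2l; first by rewrite lee_fin exprn_ge0.
    apply: le_measure; rewrite ?inE //=; first exact: bigcupT_measurable.
      exact: measurable_cell.
    by move=> x [l _ []].
  by rewrite /root_cell measure_cell // -EFinM ltry.
- move=> x /= /not_implyP[x0 /not_implyP[xgood xK]].
  apply: contrapT => xlim; apply: xK.
  have [L xL] : exists L, forall l, (L <= l)%N -> ~ near_bad_set l x.
    apply: contrapT => /forallNP xlim'; apply: xlim => m _ /=.
    have /existsNP[l /not_implyP[ml /contrapT xl]] := xlim' m.
    by exists l.
  have [T xT] := ancestor_shift_eventually L x0.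
  exists (maxn (T + L) k0) => k; rewrite geq_max => /andP[TLk k0k] v vM jk.
  set j := shift_index _ _ in jk *; apply: contrapT => jbad.
  pose Q l := `[< [/\ (k0 <= l)%N, (l <= k)%N & ~ Good l (ancestor (k - l) j)] >].
  have exQ : exists l, Q l.
    exists k; apply/asboolP; split=> //; rewrite subnn.
    by rewrite (_ : ancestor 0 j = j) //; apply/ffunP => i; rewrite ffunE divn1.
  case: (ex_minnP exQ) => l /asboolP[k0l lk lbad] lmin.
  (* The maximal bad ancestor of the bad cell [j]. *)
  have lfirst : first_bad l (ancestor (k - l) j).
    split=> //; first by apply: in_root_ancestor; rewrite subnK.
    move=> t l' ll' t0 k0l'; apply: contrapT => l'bad.
    suff /lmin : Q l' by rewrite ll'; lia.
    apply/asboolP; split=> //; first by lia.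
    by move: l'bad; rewrite ancestor_add; congr (~ Good _ (ancestor _ _)); lia.
  have xl : near_bad_set l x.
    split=> //; exists (ancestor (k - l) j); split=> // i.
    have -> : cell_index a b l x = ancestor (k - l) (cell_index a b k x).
      by rewrite -(ancestor_cell_index (k - l) l x0) subnK.
    rewrite [ancestor _ _ i]ffunE [ancestor _ j i]ffunE [j i]ffunE.
    rewrite leq_div2r ?leq_addr //=.
    apply: leq_trans (leq_divDl _ _ _) _.
    by rewrite -addn1 -addnA leq_add2l addn1 ltnS (leq_trans (leq_div _ _)).
  have lL : (l < L)%N by rewrite ltnNge; apply/negP => /xL.
  apply: lbad.
  have -> : ancestor (k - l) j = ancestor (L - l) (ancestor (k - L) j).
    by rewrite ancestor_add; congr ancestor; lia.
  have -> : ancestor (k - L) j = cell_index a b L x.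
    by rewrite -(xT (k - L)%N _ v vM) ?subnK //; lia.
  have -> : ancestor (L - l) (cell_index a b L x) = cell_index a b l x.
    by rewrite -(ancestor_cell_index (L - l) l x0) subnK // ltnW.
  exact: xgood.
Qed.

End near_cells.

(** * Increment and variation of dyadic cells *)

Section cell_increments.
Context {R : realType} {n : nat}.
Variables (a b : n.-tuple R) (f : n.-tuple R -> R) (TV : R).
Hypothesis ab : forall i, tnth a i < tnth b i.
Hypothesis TV_ub : forall N p, (1 <= N)%N -> grid_partition a b N p ->
  grid_variation f N p <= TV.
Local Notation index := {ffun 'I_n -> nat}.
Local Notation mu := (completed_lebesgue_Rn R n).

Definition cell_box k (j : index) : {ffun 'I_n -> R} * {ffun 'I_n -> R} :=
  ([ffun i => (j i)%:R / 2 ^+ k], [ffun i => (j i).+1%:R / 2 ^+ k]).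

Definition cell_increment k j : R := box_increment a b f (cell_box k j).

Definition cell_variation k j : R := box_variation a b f (cell_box k j).

Let exp2_gt0 k : 0 < 2 ^+ k :> R. Proof. exact: exprn_gt0. Qed.

Lemma cell_box_unit k j : in_root k j -> sub_box (cell_box k j) (unit_box (n := n)).
Proof.
move=> /forallP jk; apply/forallP => i; rewrite !ffunE.
rewrite divr_ge0 ?(ltW (exp2_gt0 k)) //= ler_pM2r ?invr_gt0 // ler_nat leqnSn /=.
by rewrite ler_pdivrMr // mul1r -natrX ler_nat.
Qed.

Lemma cell_box_child k j e : sub_box (cell_box k.+1 (child j e)) (cell_box k j).
Proof.
apply/forallP => i; rewrite !ffunE /=.
have halve m : m%:R / 2 ^+ k = m.*2%:R / 2 ^+ k.+1 :> R.
  by rewrite exprS -muln2 natrM; field; rewrite lt0r_neq0.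
rewrite !halve !ler_pM2r ?invr_gt0 // !ler_nat leq_addr leqnSn /=.
by case: (e i); rewrite ?addn1 ?addn0 doubleS.
Qed.

Lemma children_nonoverlapping k j e e' : e != e' ->
  nonoverlapping (cell_box k.+1 (child j e)) (cell_box k.+1 (child j e')).
Proof.
move=> ee'; have [i ii] : exists i, e i != e' i.
  apply/existsP; move: ee'; apply: contraR; rewrite negb_exists => /forallP h.
  by apply/eqP/ffunP => i; apply/eqP; rewrite -[_ == _]negbK h.
apply/existsP; exists i; rewrite !ffunE /= !ler_pM2r ?invr_gt0 // !ler_nat.
by case: (e i) (e' i) ii => -[] //= _; lia.
Qed.

Lemma cell_variation_super k j : in_root k j ->
  \sum_e cell_variation k.+1 (child j e) <= cell_variation k j.
Proof.
move=> jk; pose E := {ffun 'I_n -> bool}.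
pose L := map (fun e : E => cell_box k.+1 (child j e)) (index_enum E).
have := box_variation_super ab TV_ub (L := L) (cell_box_unit jk).
rewrite big_map; apply; apply/andP; split.
  by apply/allP => _ /mapP[e _ ->]; exact: cell_box_child.
rewrite pairwise_map; have := index_enum_uniq E; rewrite uniq_pairwise.
by apply: sub_pairwise => e e' /=; exact: children_nonoverlapping.
Qed.

(** The children are the cells of a grid with two steps on every axis. *)
Lemma cell_increment_children k j :
  \sum_e cell_increment k.+1 (child j e) = cell_increment k j.
Proof.
pose P (i : 'I_n) (q : nat) : R :=
  tnth a i + (tnth b i - tnth a i) * (((j i).*2 + q)%N%:R / 2 ^+ k.+1).
have grid := @joint_increment_grid _ n f 2 P (fun=> 0%N) (fun=> 2%N) (fun=> isT).
have -> : cell_increment k j =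
    joint_increment f [tuple P i 0%N | i < n] [tuple P i 2%N | i < n].
  congr joint_increment; apply: eq_mktuple => i; rewrite /P ffunE.
    by rewrite addn0 exprS -muln2 natrM; congr (_ + _ * _); field; rewrite lt0r_neq0.
  rewrite exprS (_ : (j i).*2 + 2 = (j i).+1 * 2)%N; last by lia.
  by rewrite natrM; congr (_ + _ * _); field; rewrite lt0r_neq0.
rewrite grid.
pose h (e : {ffun 'I_n -> bool}) : {ffun 'I_n -> 'I_2} :=
  [ffun i => inord (e i)].
pose h' (q : {ffun 'I_n -> 'I_2}) : {ffun 'I_n -> bool} :=
  [ffun i => (q i : nat) == 1%N].
rewrite (reindex h) /=; last first.
  exists h' => e _; apply/ffunP => i; rewrite !ffunE.
    by rewrite inordK; [case: (e i) | case: (e i)].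
  by apply/val_inj; case: (e i) => -[|[|]] //= _; rewrite inordK.
apply: eq_big => [e|e _].
  by apply/esym/forallP => i; rewrite ltn_ord.
congr joint_increment; apply: eq_mktuple => i; rewrite /P !ffunE.
  by rewrite inordK //; case: (e i).
by rewrite inordK ?addnS //; case: (e i).
Qed.

Lemma cell_increment_le_variation k j : in_root k j ->
  `|cell_increment k j| <= cell_variation k j.
Proof.
move=> jk; apply: (le_box_variation ab TV_ub (cell_box_unit jk)).
exact: sub_box_refl (cell_box_unit jk).
Qed.

Let ratio (G : nat -> index -> R) k x :=
  G k (cell_index a b k x) / cell_volume a b k.

Lemma ae_cell_variation_bounded : {ae mu, forall x, root_cell a b x ->
  exists B, forall k, ratio cell_variation k x <= B}.
Proof.
apply: (ae_cell_ratio_bounded ab) => k j jk; last exact: cell_variation_super.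
exact: le_trans (normr_ge0 _) (cell_increment_le_variation jk).
Qed.

(** The increment is the difference of two nonnegative superadditive functions,
    variation + increment and variation. *)
Lemma ae_cvg_cell_increment : {ae mu, forall x, root_cell a b x ->
  cvg (ratio cell_increment k x @[k --> \oo])}.
Proof.
have cvV : {ae mu, forall x, root_cell a b x -> cvg (ratio cell_variation k x @[k --> \oo])}.
  apply: (ae_cvg_cell_ratio ab) => k j jk; last exact: cell_variation_super.
  exact: le_trans (normr_ge0 _) (cell_increment_le_variation jk).
pose H k j := cell_variation k j + cell_increment k j.
have cvH : {ae mu, forall x, root_cell a b x -> cvg (ratio H k x @[k --> \oo])}.
  apply: (ae_cvg_cell_ratio ab) => k j jk; rewrite /H.
    have := cell_increment_le_variation jk; rewrite ler_norml => /andP[+ _].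
    by rewrite -subr_ge0 opprK addrC.
  by rewrite big_split /= cell_increment_children lerD2r; exact: cell_variation_super.
apply: ae_completedS (ae_completedI cvV cvH) => x [xV xH] x0.
have -> : ratio cell_increment ^~ x = (fun k => ratio H k x - ratio cell_variation k x).
  by apply/funext => k; rewrite /ratio /H -mulrBl addrAC subrr add0r.
by apply: is_cvgB; [exact: xH | exact: xV].
Qed.

End cell_increments.

(** * Cubes with a corner at a given point *)

(** Cells on one face of a cube: the remaining n - 1 coordinates are free. *)
Lemma card_ffun_coord (n N : nat) (i : 'I_n) (v : nat) :
  (#|[pred t : {ffun 'I_n -> 'I_N} | (t i : nat) == v]| <= N ^ n.-1)%N.
Proof.
pose F (i' : 'I_n) : pred 'I_N :=
  if i' == i then [pred q : 'I_N | (q : nat) == v] else predT.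
have sub : {subset [pred t : {ffun 'I_n -> 'I_N} | (t i : nat) == v] <= family F}.
  move=> t; rewrite inE => tv; apply/familyP => i'; rewrite /F.
  by case: eqP => // ->; rewrite inE.
apply: (@leq_trans #|family F|); first by apply: subset_leq_card; apply/fintype.subsetP.
rewrite card_family foldrE big_map big_enum /= (bigD1 i) //=.
rewrite -[leqRHS]mul1n leq_mul //.
  rewrite /F eqxx; have [vN|Nv] := ltnP v N.
    rewrite -(card1 (Ordinal vN)); apply: subset_leq_card; apply/fintype.subsetP => q.
    by rewrite !inE.
  rewrite eq_card0 // => q; rewrite !inE; apply/negP => /eqP qv.
  by have := ltn_ord q; rewrite qv ltnNge Nv.
rewrite (eq_bigr (fun=> N)) => [|i' /negPf i'i]; last by rewrite /F i'i card_ord.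
by rewrite prod_nat_const cardC1 card_ord.
Qed.

Section cube_sandwich.
Context {R : realType} {n : nat}.
Variables (a b : n.-tuple R) (f : n.-tuple R -> R) (TV : R).
Hypothesis ab : forall i, tnth a i < tnth b i.
Hypothesis TV_ub : forall N p, (1 <= N)%N -> grid_partition a b N p ->
  grid_variation f N p <= TV.
Local Notation w i := (tnth b i - tnth a i).
Local Notation inc := (cell_increment a b f).
Local Notation vari := (cell_variation a b f).
Local Notation vol := (cell_volume a b).
Local Notation sc := (scaled_coord a b).

Let w_gt0 i : 0 < w i. Proof. by rewrite subr_gt0. Qed.

Section one_cube.
Variables (x : n.-tuple R) (h D lam eps : R) (k N : nat).
Hypotheses (x0 : root_cell a b x) (h0 : 0 < h) (eps0 : 0 <= eps) (lam0 : 0 <= lam).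
Hypothesis xh : forall i, tnth x i + h < tnth b i.

Let c := cell_index a b k x.
Let t i := 2 ^+ k * (h / w i).
Let r i := (Num.truncn (sc k x i + t i) - c i).+1.

Hypothesis hN : forall i, 2 ^+ k * h / w i + 2 <= N%:R.
Hypothesis near_inc : forall v, (forall i, (v i <= N)%N) ->
  in_root k (shift_index c v) ->
  `|inc k (shift_index c v) - D * vol k| <= eps * vol k.
Hypothesis near_var : forall v, (forall i, (v i <= N)%N) ->
  in_root k (shift_index c v) -> vari k (shift_index c v) <= lam * vol k.

(** With the integers as intermediate nodes, all the pieces but the two extreme
    ones on each axis are sides of whole cells. *)
Let Y i q : R :=
  if q == 0%N then sc k x i else if (q < r i)%N then (c i + q)%:R
  else sc k x i + t i.

Let t_gt0 i : 0 < t i.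
Proof. by rewrite mulr_gt0 ?exprn_gt0 // divr_gt0. Qed.

Let scP i : (c i)%:R <= sc k x i < (c i)%:R + 1.
Proof. by have := mem_cell_index k x0 i; rewrite -natr1. Qed.

Let endP i : (c i + r i)%:R - 1 <= sc k x i + t i < (c i + r i)%:R.
Proof.
have /andP[x1 x2] := scP i.
have e0 : 0 <= sc k x i + t i.
  by rewrite addr_ge0 ?(ltW (t_gt0 i)) // scaled_coord_ge0.
have /andP[e1 e2] := truncn_itv e0.
have cB : (c i <= Num.truncn (sc k x i + t i))%N.
  rewrite -ltnS -(ltr_nat R); apply: le_lt_trans e2.
  by rewrite (le_trans x1) // lerDl (ltW (t_gt0 i)).
by rewrite /r addnS subnKC // -natr1 addrK e1 natr1.
Qed.

Let r_le i : (r i <= N)%N.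
Proof.
rewrite -(ler_nat R); apply: le_trans (hN i).
have /andP[x1 x2] := scP i; have /andP[e1 e2] := endP i.
by move: e1; rewrite natrD /t mulrA; lra.
Qed.

Let in_root_shift v : (forall i, (v i < r i)%N) -> in_root k (shift_index c v).
Proof.
move=> vr; apply/forallP => i; rewrite ffunE -(ltr_nat R) natrX.
apply: le_lt_trans (_ : sc k x i + t i < _); last first.
  rewrite /sc /t -mulrDr gtr_pMr ?exprn_gt0 // /unit_coord -mulrDl.
  by rewrite ltr_pdivrMr // mul1r; have := xh i; lra.
have /andP[e1 _] := endP i; apply: le_trans e1.
by rewrite lerBrDr natr1 ler_nat -addnS leq_add2l.
Qed.

Let Y_step i q : (q < r i)%N ->
  [/\ (c i + q)%:R <= Y i q, Y i q <= Y i q.+1 & Y i q.+1 <= (c i + q).+1%:R].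
Proof.
move=> qr; have /andP[x1 x2] := scP i; have /andP[e1 e2] := endP i.
rewrite /Y /= qr; have [q1r|rq1] := ltnP q.+1 (r i).
  rewrite addnS lexx; case: q qr q1r => [|q] qr q1r /=; rewrite ?addn0 ?x1.
    by split=> //; rewrite -natr1 ltW.
  by split=> //; rewrite ler_nat.
have rE : r i = q.+1 by apply/eqP; rewrite eqn_leq qr rq1.
rewrite rE addnS -natr1 addrK in e1 e2; rewrite -natr1.
case: q qr {rq1 rE} e1 e2 => [|q] qr e1 e2 /=; rewrite ?addn0.
  split; [exact: x1 | by rewrite lerDl (ltW (t_gt0 i)) |].
  by apply: ltW; move: e2; rewrite addn0.
by split=> //; exact: ltW.
Qed.

Let Y_inner i q : (0 < q)%N -> (q.+1 < r i)%N ->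
  Y i q = (c i + q)%:R /\ Y i q.+1 = (c i + q).+1%:R.
Proof.
by case: q => // q _ q1r; rewrite /Y /= q1r (ltn_trans _ q1r) // !addnS.
Qed.

Let piece (s : 'I_n -> nat) : {ffun 'I_n -> R} * {ffun 'I_n -> R} :=
  ([ffun i => Y i (s i) / 2 ^+ k], [ffun i => Y i (s i).+1 / 2 ^+ k]).

Let exp2V_gt0 : 0 < (2 ^+ k)^-1 :> R. Proof. by rewrite invr_gt0 exprn_gt0. Qed.

Let piece_sub_cell s : (forall i, (s i < r i)%N) ->
  sub_box (piece s) (cell_box k (shift_index c s)).
Proof.
move=> sr; apply/forallP => i; rewrite !ffunE !ler_pM2r //.
have [+ h2 +] := Y_step (sr i); rewrite /c ffunE => h1 h3.
by rewrite h1 h2 h3.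
Qed.

Let inner (s : 'I_n -> nat) := [forall i, (0 < s i)%N && ((s i).+1 < r i)%N].

Let vpiece s : R := \prod_(i < n) (w i / 2 ^+ k * (Y i (s i).+1 - Y i (s i))).

Let vpiece_ge0 s : (forall i, (s i < r i)%N) -> 0 <= vpiece s.
Proof.
move=> sr; apply: prodr_ge0 => i _; have [_ h2 _] := Y_step (sr i).
by rewrite mulr_ge0 ?subr_ge0 // ltW // mulr_gt0.
Qed.

Let vpiece_le s : (forall i, (s i < r i)%N) -> vpiece s <= vol k.
Proof.
move=> sr; apply: ler_prod => i _; have [h1 h2 h3] := Y_step (sr i).
have wk : 0 < w i / 2 ^+ k by rewrite mulr_gt0.
rewrite mulr_ge0 ?subr_ge0 ?(ltW wk) //= ler_piMr ?(ltW wk) //.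
by move: h3; rewrite -natr1; lra.
Qed.

(** The dyadic hyperplanes cut the cube into pieces.  An inner piece is a whole
    cell, where the increment is close to [D] times the volume; a piece at the
    boundary is only part of a cell, and is controlled by the variation of that
    cell. *)
Let piece_bound s : (forall i, (s i < r i)%N) ->
  `|box_increment a b f (piece s) - D * vpiece s| <=
  eps * vpiece s + (if inner s then 0 else (lam + `|D|) * vol k).
Proof.
move=> sr; have sN i : (s i <= N)%N by rewrite (leq_trans (ltnW (sr i))).
have scell := in_root_shift sr.
case: ifP => [/forallP s_in|_].
  have vE : vpiece s = vol k.
    apply: eq_bigr => i _; have /andP[si1 si2] := s_in i.
    have [-> ->] := Y_inner si1 si2.
    by rewrite -[(c i + s i).+1%:R]natr1 addrAC subrr add0r mulr1.
  rewrite addr0 vE; apply: le_trans (near_inc sN scell); rewrite le_eqVlt.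
  apply/orP; left; apply/eqP; congr (`|box_increment _ _ _ _ - _|).
  congr pair; apply/ffunP => i; rewrite !ffunE; have /andP[si1 si2] := s_in i;
  by have [E1 E2] := Y_inner si1 si2; rewrite ?E1 ?E2 /c ffunE.
have v0 := vpiece_ge0 sr.
have step1 : `|box_increment a b f (piece s)| <= lam * vol k.
  apply: le_trans (near_var sN scell).
  exact: (le_box_variation ab TV_ub (cell_box_unit scell) (piece_sub_cell sr)).
rewrite (le_trans (ler_normB _ _)) // normrM (ger0_norm v0) mulrDl.
apply: (@le_trans _ _ (lam * vol k + `|D| * vol k)).
  by apply: lerD => //; rewrite ler_wpM2l // vpiece_le.
by rewrite lerDr mulr_ge0.
Qed.

(** Summing the bounds on the pieces: at most 2 n N^(n-1) of them touch the
    boundary. *)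
Lemma cube_increment_bound :
  `|joint_increment f x [tuple tnth x i + h | i < n] - D * h ^+ n| <=
  eps * h ^+ n + (lam + `|D|) * vol k * (2 * n * N ^ n.-1)%N%:R.
Proof.
pose P i q := tnth a i + w i * (Y i q / 2 ^+ k).
pose volf (y : n.-tuple R) := \prod_(i < n) tnth y i.
have grid g := @joint_increment_grid _ n g N P (fun=> 0%N) r.
have r_ok i : (0 <= r i <= N)%N by rewrite r_le.
have start : x = [tuple P i 0%N | i < n].
  apply: eq_from_tnth => i; rewrite tnth_mktuple /P /Y /= /scaled_coord /unit_coord.
  by field; rewrite expf_neq0 ?lt0r_neq0.
have stop : [tuple tnth x i + h | i < n] = [tuple P i (r i) | i < n].
  apply: eq_from_tnth => i; rewrite !tnth_mktuple /P /Y /= ltnn /t.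
  rewrite /scaled_coord /unit_coord.
  by field; rewrite expf_neq0 ?lt0r_neq0.
have pieceE (s : {ffun 'I_n -> 'I_N}) :
    joint_increment f [tuple P i (s i) | i < n] [tuple P i (s i).+1 | i < n] =
    box_increment a b f (piece (fun i => s i)).
  by congr joint_increment; apply: eq_mktuple => i; rewrite /P ffunE.
have volE (s : {ffun 'I_n -> 'I_N}) :
    joint_increment volf [tuple P i (s i) | i < n] [tuple P i (s i).+1 | i < n] =
    vpiece (fun i => s i).
  rewrite joint_increment_volume; apply: eq_bigr => i _; rewrite !tnth_mktuple /P.
  by field; rewrite expf_neq0.
have hE : h ^+ n = \sum_(s : {ffun 'I_n -> 'I_N} | [forall i, (0 <= s i < r i)%N])
    vpiece (fun i => s i).
  under eq_bigr => s _ do rewrite -volE.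
  rewrite -grid // -start -stop joint_increment_volume.
  rewrite (eq_bigr (fun=> h)) ?prodr_const ?card_ord // => i _.
  by rewrite tnth_mktuple addrC addKr.
rewrite {1}start stop grid // {1 2}hE !mulr_sumr -sumrB.
under eq_bigr => s _ do rewrite pieceE.
apply: le_trans (ler_norm_sum _ _ _) _.
apply: (@le_trans _ _ (\sum_(s : {ffun 'I_n -> 'I_N} | [forall i, (0 <= s i < r i)%N])
   (eps * vpiece (fun i => s i) + (if inner (fun i => s i) then 0 else (lam + `|D|) * vol k)))).
  by apply: ler_sum => s /forallP sr; apply: piece_bound.
rewrite big_split /= lerD2l.
set C := (lam + `|D|) * vol k.
have C0 : 0 <= C by rewrite mulr_ge0 ?addr_ge0 ?(ltW (cell_volume_gt0 ab k)).
pose on_face (i : 'I_n) (s : {ffun 'I_n -> 'I_N}) : R :=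
  ((s i : nat) == 0%N)%:R + ((s i : nat) == (r i).-1)%:R.
apply: (@le_trans _ _ (\sum_(s : {ffun 'I_n -> 'I_N}) C * \sum_(i < n) on_face i s)).
  rewrite big_mkcond /=; apply: ler_sum => s _.
  have face_ge0 i : 0 <= on_face i s by rewrite addr_ge0.
  case: ifP => [/forallP sr|_]; last by rewrite mulr_ge0 ?sumr_ge0.
  case: ifP => [_|/negbT]; first by rewrite mulr_ge0 ?sumr_ge0.
  rewrite negb_forall => /existsP[i si]; rewrite ler_peMr // (bigD1 i) //=.
  rewrite -[leLHS]addr0 lerD ?sumr_ge0 // /on_face.
  have -> : ((s i : nat) == (r i).-1) = ((s i).+1 == r i) by rewrite eqSS.
  move: si; rewrite negb_and -eqn0Ngt -leqNgt => /orP[->|rsi]; first by rewrite lerDl.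
  have -> : (s i).+1 == r i by rewrite eqn_leq rsi andbT; exact: sr.
  by rewrite lerDr.
rewrite -mulr_sumr ler_wpM2l // exchange_big /=.
have count_face i v :
    \sum_(s : {ffun 'I_n -> 'I_N}) ((s i : nat) == v)%:R <= (N ^ n.-1)%:R :> R.
  rewrite -natr_sum ler_nat; apply: leq_trans (card_ffun_coord N i v).
  by rewrite -sum1_card [leqRHS]big_mkcond /=; apply: leq_sum => s _; rewrite inE; case: eqP.
apply: (@le_trans _ _ (\sum_(i < n) (2 * N ^ n.-1)%N%:R)).
  apply: ler_sum => i _; rewrite big_split /= mul2n -addnn natrD.
  by apply: lerD; exact: count_face.
by rewrite sumr_const card_ord -mulrnA ler_nat mulnAC.
Qed.

End one_cube.

(** The level at which a cube of side [h] measures between [m] and [2 m] units. *)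
Lemma dyadic_scale (m K : nat) : (0 < m)%N -> exists2 d : R, 0 < d &
  forall h, 0 < h -> h < d ->
    exists k, [/\ (K <= k)%N, m%:R <= 2 ^+ k * h & 2 ^+ k * h <= 2 * m%:R].
Proof.
move=> m0; exists (m%:R / 2 ^+ K); first by rewrite divr_gt0 ?exprn_gt0 ?ltr0n.
move=> h h0; rewrite ltr_pdivlMr ?exprn_gt0 // mulrC => hK.
have exk : exists k, m%:R <= 2 ^+ k * h.
  exists (Num.truncn (m%:R / h)).+1; rewrite -ler_pdivrMr //.
  apply: ltW; apply: (lt_le_trans (truncnS_gt _)).
  by rewrite -natrX ler_nat ltnW // ltn_expl.
case: (ex_minnP exk) => k mk kmin.
have Kk : (K <= k)%N.
  rewrite leqNgt; apply/negP => kK; move: hK; rewrite ltNge => /negP; apply.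
  apply: (le_trans mk); rewrite ler_pM2r // ler_eXn2l ?ltr1n //.
  exact: ltnW.
exists k; split=> //; case: k kmin {mk Kk} => [|k] kmin.
  rewrite expr0 mul1r; apply: (@le_trans _ _ (2 ^+ K * h)).
    by rewrite ler_peMl ?(ltW h0) // exprn_ege1 // ler1n.
  by apply: (le_trans (ltW hK)); rewrite ler_peMl // ler1n.
rewrite exprS -mulrA ler_pM2l // leNgt; apply/negP => /ltW /kmin.
by rewrite ltnn.
Qed.

(** With cells of side about h / m, the boundary term of [cube_increment_bound]
    is of order h^n / m; [m] is chosen first, then [h] tends to 0. *)
Lemma cvg_joint_quotient (x : n.-tuple R) (D lam : R) : (0 < n)%N ->
  root_cell a b x ->
  (forall eps N, 0 < eps -> exists K, forall k, (K <= k)%N ->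
     forall v, (forall i, (v i <= N)%N) ->
     in_root k (shift_index (cell_index a b k x) v) ->
     `|inc k (shift_index (cell_index a b k x) v) - D * vol k| <= eps * vol k) ->
  (forall N, exists K, forall k, (K <= k)%N -> forall v, (forall i, (v i <= N)%N) ->
     in_root k (shift_index (cell_index a b k x) v) ->
     vari k (shift_index (cell_index a b k x) v) <= lam * vol k) ->
  joint_quotient f x h @[h --> 0^'+] --> D.
Proof.
move=> n0 x0 near_inc near_var; apply/cvgrPdist_le => e e0.
pose lam' := Num.max lam 0.
have lam'0 : 0 <= lam' by rewrite le_max lexx orbT.
(* On each axis the cube meets at most C m cells. *)
pose C := (\sum_(i < n) (Num.truncn (2 / w i + 2)).+1)%N.
have C_ub i : 2 / w i + 2 <= C%:R.
  apply: le_trans (ltW (truncnS_gt _)) _; rewrite ler_nat /C (bigD1 i) //=.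
  exact: leq_addr.
pose W := \prod_(i < n) w i.
pose A := (lam' + `|D|) * W * (2 * n * C ^ n.-1)%N%:R.
have A0 : 0 <= A.
  by rewrite !mulr_ge0 // ?addr_ge0 // prodr_ge0 // => i _; exact: ltW.
(* The boundary contributes at most A / m <= e / 2 times h^n. *)
pose m := (Num.truncn (2 * A / e)).+1.
have mA : A <= e / 2 * m%:R.
  have : 2 * A / e < m%:R by exact: truncnS_gt.
  by rewrite ltr_pdivrMr //; lra.
have m0 : (0 < m)%N by [].
have e2 : 0 < e / 2 by rewrite divr_gt0.
have [K1 K1P] := near_inc _ (C * m)%N e2.
have [K2 K2P] := near_var (C * m)%N.
have [d d0 dP] := dyadic_scale (maxn K1 K2) m0.
near=> h.
have h0 : 0 < h by [].
have [k [Kk mk km]] : exists k, [/\ (maxn K1 K2 <= k)%N,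
    m%:R <= 2 ^+ k * h & 2 ^+ k * h <= 2 * m%:R].
  by apply: dP => //; near: h; exact: nbhs_right_lt.
have xh i : tnth x i + h < tnth b i.
  rewrite -ltrBrDl; move: i; near: h; apply: filter_forall => i.
  apply: nbhs_right_lt; rewrite subr_gt0.
  have /andP[_] := unit_coord_root i x0.
  by rewrite /unit_coord ltr_pdivrMr // mul1r; lra.
move: Kk; rewrite geq_max => /andP[K1k K2k].
have hN i : 2 ^+ k * h / w i + 2 <= (C * m)%N%:R.
  rewrite natrM; apply: le_trans (_ : (2 / w i + 2) * m%:R <= _); last first.
    by rewrite ler_wpM2r.
  rewrite mulrDl lerD //; first by rewrite [leRHS]mulrAC ler_pM2r ?invr_gt0.
  by rewrite ler_peMr // ler1n.
have vark v : (forall i, (v i <= C * m)%N) ->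
    in_root k (shift_index (cell_index a b k x) v) ->
    vari k (shift_index (cell_index a b k x) v) <= lam' * vol k.
  move=> vN vk; apply: le_trans (K2P k K2k v vN vk) _.
  by rewrite ler_pM2r ?cell_volume_gt0 // le_max lexx.
have := cube_increment_bound x0 h0 (ltW e2) lam'0 xh hN (K1P k K1k) vark.
set X := _ * _%:R; set J := joint_increment _ _ _ => JX.
have hn : 0 < h ^+ n by rewrite exprn_gt0.
have XA : X * m%:R <= A * h ^+ n.
  have volE : vol k * (2 ^+ k * h) ^+ n = W * h ^+ n.
    rewrite /cell_volume big_split /= prodr_const card_ord exprMn.
    by rewrite -mulrA [(_^-1 ^+ n) * _]mulrA -exprMn mulVf ?expr1n ?mul1r // expf_neq0.
  have -> : X * m%:R = (lam' + `|D|) * (2 * n * C ^ n.-1)%N%:R * (vol k * m%:R ^+ n).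
    have mE : (2 * n * (C * m) ^ n.-1)%N%:R * m%:R =
        (2 * n * C ^ n.-1)%N%:R * m%:R ^+ n :> R.
      rewrite -natrX -!natrM; congr (_%:R).
      by rewrite expnMn -(prednK n0) /= expnSr !mulnA.
    by rewrite /X -[LHS]mulrA mE mulrACA mulrA.
  have -> : A * h ^+ n = (lam' + `|D|) * (2 * n * C ^ n.-1)%N%:R * (W * h ^+ n).
    by rewrite /A; ring.
  rewrite -volE ler_wpM2l ?mulr_ge0 ?addr_ge0 // ler_pM2l ?cell_volume_gt0 //.
  by rewrite lerXn2r ?nnegrE // (le_trans _ mk).
have {}XA : X <= e / 2 * h ^+ n.
  rewrite -(ler_pM2r (_ : 0 < m%:R)) ?ltr0n //; apply: (le_trans XA).
  by rewrite [leRHS]mulrAC ler_pM2r.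
rewrite distrC -(ler_pM2r hn) -{1}(gtr0_norm hn) -normrM /joint_quotient mulrBl.
rewrite divfK ?lt0r_neq0 //; apply: (le_trans JX); lra.
Unshelve. all: by end_near.
Qed.
End cube_sandwich.

(** * Almost everywhere limits for a complete measure *)

Section ae_limits.
Context d (T : measurableType d) (R : realType) (mu : {measure set T -> \bar R}).
Hypothesis mu_complete : measure_is_complete mu.
Variables (A : set T) (h : (T -> R)^nat) (g : T -> R).
Hypothesis mA : measurable A.
Hypothesis mh : forall k, measurable_fun A (h k).
Hypothesis hg : {ae mu, forall x, A x -> h k x @[k --> \oo] --> g x}.
Local Open Scope ereal_scope.

(** The limit agrees almost everywhere with an upper limit of measurable
    functions. *)
Lemma measurable_ae_limit : measurable_fun A g.
Proof.
apply/measurable_EFinP.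
apply: (ae_measurable_fun mu_complete (f := fun x => limn_esup (fun k => (h k x)%:E))).
  apply: filterS hg => x xh Ax; rewrite /=.
  have hgx : (h k x)%:E @[k --> \oo] --> (g x)%:E by apply: cvg_EFin; [exact: nearW | exact: xh].
  by rewrite (cvg_limn_einf_sup hgx).
by apply: measurable_fun_limn_esup => k; exact/measurable_EFinP.
Qed.

Lemma integral_ae_limit_le (C : \bar R) :
  (forall k, \int[mu]_(x in A) `|h k x|%:E <= C) ->
  \int[mu]_(x in A) `|g x|%:E <= C.
Proof.
move=> hC; have mg := measurable_ae_limit.
pose u k x := `|h k x|%:E.
have gE : ae_eq mu A (fun x => `|g x|%:E) (fun x => limn_einf (u ^~ x)).
  apply: filterS hg => x xh Ax.
  have ux : u k x @[k --> \oo] --> `|g x|%:E.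
    by apply: cvg_EFin; [exact: nearW | apply: cvg_norm; exact: xh].
  by rewrite (cvg_limn_einf_sup ux).
have mng : measurable_fun A (fun x => `|g x|%:E).
  by apply/measurable_EFinP; exact: measurableT_comp.
have mu_ k : measurable_fun A (u k).
  by apply/measurable_EFinP; exact: measurableT_comp.
have mlim : measurable_fun A (fun x => limn_einf (u ^~ x)).
  exact: ae_measurable_fun gE mng.
have lim_ge0 x : 0 <= limn_einf (u ^~ x).
  rewrite limn_einf_lim; apply: lime_ge; first exact: is_cvg_einfs.
  apply: nearW => k; apply: le_ereal_inf_tmp => _ [m _ <-].
  by rewrite lee_fin.
rewrite (ge0_ae_eq_integral mA mng mlim) => [|x _|x _|]; last 1 first.
- exact: gE.
- by apply: le_trans (fatou mu mA mu_ _) _; [by move=> k x _; rewrite lee_fin |];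
    rewrite limn_einf_lim; apply: lime_le; [exact: is_cvg_einfs |];
    apply: nearW => k; apply: le_trans (hC k); apply: ereal_inf_lbound; exists k => /=.
- by rewrite lee_fin.
- exact: lim_ge0.
Qed.

End ae_limits.

(** * The joint derivative *)

Section almost_everywhere_derivable.
Context {R : realType} {n : nat}.
Variables (a b : n.-tuple R) (f : n.-tuple R -> R) (TV : R).
Hypothesis n_gt0 : (0 < n)%N.
Hypothesis ab : forall i, tnth a i < tnth b i.
Hypothesis TV_ub : forall N p, (1 <= N)%N -> grid_partition a b N p ->
  grid_variation f N p <= TV.
Local Notation w i := (tnth b i - tnth a i).
Local Notation index := {ffun 'I_n -> nat}.
Local Notation mu := (completed_lebesgue_Rn R n).
Local Notation inc := (cell_increment a b f).
Local Notation vari := (cell_variation a b f).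
Local Notation vol := (cell_volume a b).
Local Notation cix := (cell_index a b).

Let vol_gt0 k : 0 < vol k. Proof. exact: cell_volume_gt0. Qed.

Lemma ae_off_hyperplanes (c : n.-tuple R) :
  {ae mu, forall x : n.-tuple R, forall i, tnth x i != tnth c i}.
Proof.
apply: ae_forall_count => i.
pose A (j : 'I_n) : set (measurableTypeR R) := if j == i then [set tnth c i] else setT.
have mA j : measurable (A j).
  by rewrite /A; case: ifP => _; [exact: measurable_set1 | exact: measurableT].
exists [set x | forall j, A j (tnth x j)]; split.
- exact: measurable_completed (measurable_tuple_prod mA).
- transitivity (lebesgue_Rn R n [set x | forall j, A j (tnth x j)]).
    exact: completed_lebesgue_RnE (measurable_tuple_prod mA).
  rewrite (lebesgue_Rn_prod mA) (bigD1 i) //= /A eqxx.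
  by rewrite lebesgue_measure_set1 mul0e.
- move=> x /= /negP; rewrite negbK => /eqP xi j; rewrite /A.
  by case: eqP => // ->.
Qed.

Lemma ae_rectangle_interior : {ae mu, forall x : n.-tuple R, rectangle a b x ->
  root_cell a b x /\ forall i, tnth a i < tnth x i < tnth b i}.
Proof.
apply: ae_completedS (ae_completedI (ae_off_hyperplanes a) (ae_off_hyperplanes b)).
move=> x [xa xb] xab.
have xin i : tnth a i < tnth x i < tnth b i.
  by have /andP[x1 x2] := xab i; rewrite !lt_neqAle x1 x2 xb eq_sym xa.
split=> // i; have /andP[x1 x2] := xin i; rewrite ffunE /scaled_coord expr0 mul1r.
by rewrite /unit_coord divr_ge0 ?subr_ge0 ?ltW //= ltr_pdivrMr ?subr_gt0 // mul1r ltrD2r.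
Qed.

Let nearby_inherits (P : nat -> index -> Prop) k0 N (x : n.-tuple R) :=
  root_cell a b x -> (forall k, (k0 <= k)%N -> P k (cix k x)) ->
  exists K, forall k, (K <= k)%N -> forall v, (forall i, (v i <= N)%N) ->
    in_root k (shift_index (cix k x) v) -> P k (shift_index (cix k x) v).

Let between (p q : rat) k j := ratr p * vol k <= inc k j <= ratr q * vol k.

Let ae_near_between : {ae mu, forall x, forall i : rat * rat * (nat * nat),
  nearby_inherits (between i.1.1 i.1.2) i.2.1 i.2.2 x}.
Proof. by apply: ae_forall_count => i; exact: ae_near_cells. Qed.

Let ae_near_variation : {ae mu, forall x, forall i : nat * nat,
  nearby_inherits (fun k j => vari k j <= i.1%:R * vol k) 0 i.2 x}.
Proof.
apply: ae_forall_count => i.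
exact: (ae_near_cells ab (fun k j => vari k j <= i.1%:R * vol k)).
Qed.

(** [ae_near_cells] is used for countably many properties: membership of the
    ratio in rational bands around its limit, and integer bounds on the
    variation. *)
Lemma ae_cvg_joint_quotient : {ae mu, forall x, rectangle a b x ->
  [/\ root_cell a b x, forall i, tnth a i < tnth x i < tnth b i &
   exists2 D : R, joint_quotient f x h @[h --> 0^'+] --> D &
     inc k (cix k x) / vol k @[k --> \oo] --> D]}.
Proof.
have cvg_bnd := ae_completedI (ae_cvg_cell_increment ab TV_ub)
  (ae_cell_variation_bounded ab TV_ub).
apply: ae_completedS (ae_completedI ae_rectangle_interior
  (ae_completedI cvg_bnd (ae_completedI ae_near_between ae_near_variation))).
move=> x [x_in [[x_cvg x_bnd] [x_btw x_var]]] xab.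
have [x0 xi] := x_in xab; split=> //.
have /cvg_ex[D xD] := x_cvg x0.
exists D => //; have [B xB] := x_bnd x0.
pose lam := (Num.truncn B).+1.
apply: (@cvg_joint_quotient _ _ a b f TV ab TV_ub x D lam%:R) => //; last first.
  move=> N; apply: (x_var (lam, N) x0) => k _ /=.
  rewrite -ler_pdivrMr //; apply: le_trans (xB k) _.
  exact: ltW (truncnS_gt _).
move=> eps N eps0.
have [p] : exists q : rat, ratr q \in `]D - eps, D[.
  by apply: rat_in_itvoo; rewrite ltrBlDr ltrDl.
rewrite in_itv /= => /andP[ep pD].
have [q] : exists q : rat, ratr q \in `]D, D + eps[.
  by apply: rat_in_itvoo; rewrite ltrDl.
rewrite in_itv /= => /andP[Dq qe].
have [k0 _ xpq] : \forall k \near \oo,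
    ratr p <= inc k (cix k x) / vol k /\ inc k (cix k x) / vol k <= ratr q.
  by near=> k; split; apply: ltW; near: k; [exact: cvgr_gt xD _ _ | exact: cvgr_lt xD _ _].
have [|K xK] := x_btw (p, q, (k0, N)) x0.
  by move=> k /xpq [] /=; rewrite /between ler_pdivlMr // ler_pdivrMr // => -> ->.
exists K => k Kk v vN vk; have /andP[/=] := xK k Kk v vN vk.
set I := inc _ _ => pI Iq; rewrite ler_distl.
have h1 : (D - eps) * vol k <= ratr p * vol k by rewrite ler_pM2r // ltW.
have h2 : ratr q * vol k <= (D + eps) * vol k by rewrite ler_pM2r // ltW.
move: h1 h2; rewrite mulrBl mulrDl => h1 h2.
by rewrite (le_trans h1 pI) (le_trans Iq h2).
Unshelve. all: by end_near.
Qed.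

(** The increment ratio of level [k], extended by 0 to a simple function. *)
Let step k (x : lebesgue_type R n) : R :=
  \sum_(j : {ffun 'I_n -> 'I_(2 ^ k)})
    inc k (level_index j) / vol k * \1_(cell a b k (level_index j)) x.

Let step_cell k x : root_cell a b x -> step k x = inc k (cix k x) / vol k.
Proof.
move=> x0; have xk := mem_cell_index k x0; have /forallP ck := in_root_cell_index k x0.
pose j0 : {ffun 'I_n -> 'I_(2 ^ k)} := [ffun i => Ordinal (ck i)].
have j0E : level_index j0 = cix k x by apply/ffunP => i; rewrite ffunE [in LHS]ffunE.
rewrite /step (bigD1 j0) //= big1 ?addr0 => [|j jj0].
  by rewrite j0E indicE mem_set // mulr1.
rewrite indicE memNset ?mulr0 // => /cell_indexE xj; move/negP: jj0; apply.
by apply/eqP/ffunP => i; apply/val_inj; rewrite ffunE /= xj ffunE.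
Qed.

Let measurable_step k : measurable_fun setT (step k).
Proof.
apply: measurable_sum => j; apply: measurable_funM; first exact: measurable_cst.
by apply: measurable_indic; exact: measurable_cell.
Qed.

Let measurable_rectangle : measurable (rectangle a b : set (lebesgue_type R n)).
Proof.
pose A i : set (measurableTypeR R) := [set` `[tnth a i, tnth b i]].
have mA i : measurable (A i) by exact: measurable_itv.
rewrite (_ : rectangle a b = [set x | forall i, A i (tnth x i)]); last first.
  by apply/seteqP; split=> x /= xab i; have := xab i; rewrite /A /= in_itv.
exact: measurable_completed (measurable_tuple_prod mA).
Qed.

Let dyadic_grid_variation k :
  \sum_(j : {ffun 'I_n -> 'I_(2 ^ k)}) `|inc k (level_index j)| <= TV.
Proof.
pose p (i : 'I_n) q := tnth a i + w i * (q%:R / 2 ^+ k).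
have e2 : 0 < 2 ^+ k :> R by rewrite exprn_gt0.
have pk : grid_partition a b (2 ^ k) p.
  move=> i; split; first by rewrite /p mul0r mulr0 addr0.
    by rewrite /p natrX divff ?mulr1 ?lt0r_neq0 // addrC subrK.
  move=> q _; rewrite /p ltrD2l ltr_pM2l ?subr_gt0 //.
  by rewrite ltr_pM2r ?invr_gt0 // ltr_nat.
apply: le_trans (TV_ub _ pk); last by rewrite expn_gt0.
rewrite le_eqVlt; apply/orP; left; apply/eqP; apply: eq_bigr => j _.
by congr (`|joint_increment _ _ _|); apply: eq_mktuple => i; rewrite /p !ffunE.
Qed.

Let integral_step_le k :
  (\int[mu]_(x in rectangle a b) `|step k x|%:E <= TV%:E)%E.
Proof.
pose c j := `|inc k (@level_index n k j)| / vol k.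
have c0 j : 0 <= c j by rewrite divr_ge0 // ltW.
have mind j : measurable_fun (rectangle a b : set (lebesgue_type R n))
    (fun x => (\1_(cell a b k (@level_index n k j)) x : R)%:E).
  apply/measurable_EFinP; apply: measurable_indic; exact: measurable_cell.
apply: (@le_trans _ _ (\int[mu]_(x in rectangle a b)
    \sum_(j : {ffun 'I_n -> 'I_(2 ^ k)})
      ((c j)%:E * (\1_(cell a b k (level_index j)) x)%:E))%E).
  apply: ge0_le_integral; first exact: measurable_rectangle.
  - by move=> x _; rewrite lee_fin.
  - apply/measurable_EFinP; apply: measurableT_comp; first exact: normr_measurable.
    exact: measurable_funTS (measurable_step k).
  - apply: emeasurable_sum => j.
    by apply: emeasurable_funM; [exact: measurable_cst | exact: mind].
  - move=> x _; under eq_bigr do rewrite -EFinM.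
    rewrite sumEFin lee_fin /step; apply: le_trans (ler_norm_sum _ _ _) _.
    apply: ler_sum => j _; rewrite !normrM normfV (gtr0_norm (vol_gt0 k)).
    by rewrite (ger0_norm (_ : 0 <= \1_(_) _)).
rewrite (ge0_integral_sum mu measurable_rectangle); last 2 first.
- by move=> j; apply: emeasurable_funM; [exact: measurable_cst | exact: mind].
- by move=> j x _; rewrite -EFinM lee_fin mulr_ge0.
apply: (@le_trans _ _ (\sum_(j : {ffun 'I_n -> 'I_(2 ^ k)}) `|inc k (level_index j)|%:E)%E).
  apply: lee_sum => j _.
  rewrite (ge0_integralZl mu measurable_rectangle (mind j)); last 2 first.
  - by move=> x _; rewrite lee_fin.
  - by rewrite lee_fin.
  have mcell := measurable_cell ab k (level_index j).
  rewrite (integral_indic mu measurable_rectangle mcell).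
  apply: (@le_trans _ _ ((c j)%:E * mu (cell a b k (level_index j)))%E).
    apply: lee_wpmul2l; first by rewrite lee_fin.
    apply: le_measure; rewrite ?inE; last exact: subIsetl.
      exact: measurableI mcell measurable_rectangle.
    exact: mcell.
  rewrite [X in (_ * X <= _)%E](measure_cell ab k) -EFinM lee_fin /c.
  by rewrite divfK ?lt0r_neq0.
by rewrite sumEFin lee_fin; exact: dyadic_grid_variation.
Qed.

Let ae_step_cvg : {ae mu, forall x, rectangle a b x ->
  step k x @[k --> \oo] --> joint_derivative f x}.
Proof.
apply: ae_completedS ae_cvg_joint_quotient => x xP xab.
have [x0 _ [D xD xincD]] := xP xab.
rewrite /joint_derivative (cvg_lim _ xD) //.
by under eq_cvg do rewrite step_cell //.
Qed.

Lemma measurable_joint_derivative :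
  measurable_fun (rectangle a b : set (lebesgue_type R n)) (joint_derivative f).
Proof.
apply: (measurable_ae_limit (@completed_lebesgue_Rn_is_complete R n) _ ae_step_cvg).
by move=> k; exact: measurable_funTS (measurable_step k).
Qed.

Lemma integral_joint_derivative_le :
  (\int[mu]_(x in rectangle a b) `|joint_derivative f x|%:E <= TV%:E)%E.
Proof.
apply: (integral_ae_limit_le (@completed_lebesgue_Rn_is_complete R n) _ _ ae_step_cvg) => //.
by move=> k; exact: measurable_funTS (measurable_step k).
Qed.

End almost_everywhere_derivable.

Unset Implicit Arguments.

Theorem theorem1p5 (R : realType) (n : nat) (a b : n.-tuple R)
    (f : n.-tuple R -> R) :
  (1 <= n)%N ->
  (forall i, tnth a i < tnth b i) ->
  joint_bounded_variation a b f ->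
  [/\ {ae completed_lebesgue_Rn R n, forall x,
         rectangle a b x -> joint_derivable a b f x},
      measurable_fun (rectangle a b : set (lebesgue_type R n))
        (joint_derivative f) &
      (\int[completed_lebesgue_Rn R n]_(x in rectangle a b)
         `|joint_derivative f x|%:E <= joint_total_variation a b f)%E].
Proof.
move=> n_gt0 ab BV.
have TV_ub N p : (1 <= N)%N -> grid_partition a b N p ->
    ((grid_variation f N p)%:E <= joint_total_variation a b f)%E.
  by move=> N1 pN; apply: ereal_sup_ubound; exists N, p.
have p1 : grid_partition a b 1 (fun i q => if q == 0%N then tnth a i else tnth b i).
  by move=> i; split=> // -[|j] // _; exact: ab.
have TV_fin : joint_total_variation a b f \is a fin_num.
  by rewrite fin_numElt BV andbT (lt_le_trans _ (TV_ub 1%N _ isT p1)) ?ltNyr.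
have TVE := fineK TV_fin; set TV := fine _ in TVE.
have {}TV_ub N p : (1 <= N)%N -> grid_partition a b N p -> grid_variation f N p <= TV.
  by move=> N1 pN; rewrite -lee_fin TVE; exact: TV_ub.
split; last by rewrite -TVE; exact: integral_joint_derivative_le.
- apply: ae_completedS (ae_cvg_joint_quotient n_gt0 ab TV_ub) => x xP xab.
  by have [_ xi [D xD _]] := xP xab; split=> //; apply/cvg_ex; exists D.
- exact: measurable_joint_derivative n_gt0 ab TV_ub.
Qed.
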